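(* There is a function $\alpha(j)=\tilde{O}(\log j)$ (with absolute implied constants) such that the following holds. Let $G=(V,E,w)$ be a connected undirected graph with nonnegative edge weights, let $0<\rho<1$, and let $v_1,v_2,\dots,v_n$ be any priority ranking of $V$. Then there exists a spanner $H$ of $G$ with lightness at most $1+\rho$ and prioritized distortion $\alpha(j)/\rho$ with respect to this ranking, i.e., for all $1\le j<i\le n$, $d_H(v_j,v_i)\le \frac{\alpha(j)}{\rho}\, d_G(v_j,v_i)$.
   Context: Edge weights are assumed distinct (ties broken consistently), so the minimum spanning tree (MST) $T$ of $G$ is unique. $d_G$ denotes the shortest-path metric of $G$. A spanner of $G$ is a subgraph $H=(V,E')$, $E'\subseteq E$, with the induced weights. The lightness of $H$ is $w(H)/w(T)$, where $w(\cdot)$ is the total edge weight. A pair $u,v$ has distortion at most $t$ in $H$ if $d_H(u,v)\le t\, d_G(u,v)$. $\tilde{O}(f(x))$ means $O(f(x)\cdot \mathrm{polylog}(f(x)))$. *)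

(* Defs.v *)
From mathcomp Require Import all_boot all_order all_algebra.
From mathcomp Require Import all_classical all_reals all_analysis.
Import Order.TTheory GRing.Theory Num.Theory.
Import numFieldNormedType.Exports.

Set Implicit Arguments.
Unset Strict Implicit.
Unset Printing Implicit Defensive.

Local Open Scope ring_scope.

(** Undirected graphs on [V] are given by their set of edges, an edge being a
    two-element set of vertices.  Subgraphs keep all vertices, hence are just
    subsets of the edge set. *)

Section Graphs.
Variables (R : realType) (V : finType).
Implicit Types (E F H T : {set {set V}}) (w : {set V} -> R).

Definition is_graph E := forall e, e \in E -> #|e| = 2%N.

Definition nonneg_weights E w := forall e, e \in E -> 0 <= w e.

Definition adj F : rel V := fun x y => ([set x; y]%SET \in F).

Definition connected_graph F := forall x y : V, connect (adj F) x y.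

(* [ucycle] is a simple cycle; those of size 2 run back and forth along a
   single edge. *)
Definition acyclic F := forall c : seq V, ucycle (adj F) c -> (size c <= 2)%N.

Definition total_weight w F : R := \sum_(e in F) w e.

Definition spanning_tree E T :=
  [/\ T \subset E, connected_graph T & acyclic T].

(* When edge weights are pairwise distinct there is exactly one such [T]; in
   general the MSTs are those obtained from the various ways of breaking ties,
   and they all have the same total weight. *)
Definition is_MST E w T :=
  spanning_tree E T /\
  forall T', spanning_tree E T' -> total_weight w T <= total_weight w T'.

Definition spanner E H := H \subset E.

(* The quotient is taken in [\bar R], where 0 / 0 = 0 and x / 0 = +oo for
   x > 0: if the MST has weight 0, only spanners of weight 0 are light. *)
Definition lightness w T H : \bar R :=
  ((total_weight w H)%:E / (total_weight w T)%:E)%E.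

(* The walk visits [x] and then the vertices of [p] in order. *)
Definition walk_weight w (x : V) (p : seq V) : R :=
  \sum_(r <- pairmap (fun a b => w [set a; b]%SET) x p) r.

(* Equal to +oo when [x] and [y] are not connected in [F]. *)
Definition dist w F (x y : V) : \bar R :=
  ereal_inf [set r | exists p : seq V,
    [/\ path (adj F) x p, last x p = y & r = (walk_weight w x p)%:E]]%classic.

Definition distortion_at_most w E H (t : R) (x y : V) :=
  (dist w H x y <= t%:E * dist w E x y)%E.

(* The ranking is 0-based: [v j] is the vertex of priority [j.+1]. *)
Definition prioritized_distortion w E H n (v : 'I_n -> V) (beta : nat -> R) :=
  forall j i : 'I_n, (j < i)%N ->
    distortion_at_most w E H (beta j.+1) (v j) (v i).

End Graphs.

(** [f = O(g * polylog g)] at infinity. *)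
Definition softO (R : realType) (f g : nat -> R) :=
  exists k : nat, (f =O_\oo (fun j => (g j * ln (g j) ^+ k)%R))%classic.

(* Main.v *)
Require Import Defs.
From mathcomp Require Import all_boot all_order all_algebra.
From mathcomp Require Import all_classical all_reals all_analysis.
From mathcomp Require Import ring lra zify.
Import Order.TTheory GRing.Theory Num.Theory.
Import numFieldNormedType.Exports.
Local Open Scope ring_scope.

Set Implicit Arguments.
Unset Strict Implicit.
Unset Printing Implicit Defensive.

(** For each [i] let [K_i] consist of the first [2 ^ 2 ^ i] vertices of the
    ranking.  The spanner is the union over [i] of subgraphs that contain [T],
    have weight [(1 + O(rho / i ^ 2)) w(T)] and approximate all distances to
    [K_i] within [O(2 ^ i * i ^ 3 / rho)].  Each comes, after multiplying the
    weights outside [T] by a large factor, from a spanner of weight [O(i) w(T)]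
    with stretch [O(b)] on [K_i * V], where [#|K_i| <= 2 ^ b].

    The latter is the union of [T], of the shortest paths of a greedy
    [O(b)]-spanner of the metric on the terminals, and of shortest paths to the
    terminals from a packing of vertices.  To bound the total weight of the
    greedy chords, embed [T] in a line of length [2 w(T)] that dominates its
    metric, and treat separately the [O(log b)] residue classes of the scales
    [log2 (weight)], so that consecutive scales of a class differ by a factor
    [A >= 64 b].  Going up the scales one maintains a clustering together with
    upper bounds on the cluster diameters whose sum [Phi] starts at [O(w(T))].
    The chords of scale [s] have large girth, so by the Moore bound there are at
    most twice as many of them as clusters incident to them.  Group the clusters
    into superclusters of diameter about [b s].  Superclusters with boundedly
    many incident clusters cost [O(Phi / b)] in all, which is affordable since
    there are at most [b] scales.  The others are adjacent to many
    superclusters, and merging them with their neighbours replaces the sum of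
    many diameters by a bounded number of them: the decrease of [Phi] pays for
    their chords. *)

(** * The Moore bound for chords inserted in order *)

Section Moore.
Variables (N : finType) (M : nat) (a b : 'I_M -> N).
Implicit Types (A B : {set 'I_M}) (x y : N).
Local Open Scope nat_scope.

Definition link A : rel N := fun x y =>
  [exists j in A, ((x == a j) && (y == b j)) || ((x == b j) && (y == a j))].

Definition hops A h x y :=
  exists q, [/\ path (link A) x q, last x q = y & size q <= h].

Lemma linkP A x y : reflect
  (exists2 j, j \in A & (x = a j /\ y = b j) \/ (x = b j /\ y = a j)) (link A x y).
Proof.
apply: (iffP existsP) => [[j /andP[jA /orP[]/andP[/eqP-> /eqP->]]]|].
- by exists j => //; left.
- by exists j => //; right.
move=> [j jA [[-> ->]|[-> ->]]]; exists j; rewrite jA !eqxx //=.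
by rewrite orbT.
Qed.

Lemma link_sym A : symmetric (link A).
Proof.
move=> x y; apply/linkP/linkP => -[j jA [[-> ->]|[-> ->]]]; exists j => //;
  by [left|right].
Qed.

Lemma link_sub A B x y : A \subset B -> link A x y -> link B x y.
Proof. by move=> /fintype.subsetP AB /linkP[j /AB jB h]; apply/linkP; exists j. Qed.

Lemma hops_sub A B h h' x y :
  A \subset B -> h <= h' -> hops A h x y -> hops B h' x y.
Proof.
move=> AB hh [q [qA ql qh]]; exists q; split => //; last exact: leq_trans hh.
by apply: sub_path qA => ? ?; apply: link_sub.
Qed.

Lemma hops_cat A h h' x y z : hops A h x y -> hops A h' y z -> hops A (h + h') x z.
Proof.
move=> [q [qA ql qh]] [q' [qA' ql' qh']]; exists (q ++ q'); split.
- by rewrite cat_path qA ql.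
- by rewrite last_cat ql.
- by rewrite size_cat leq_add.
Qed.

Lemma hops_sym A h x y : hops A h x y -> hops A h y x.
Proof.
move=> [q [qA ql qh]]; exists (rev (belast x q)); split.
- rewrite -ql rev_path; apply: sub_path qA => z t; by rewrite link_sym.
- case: q ql {qA qh} => [|z q] //= _; by rewrite rev_cons last_rcons.
- by rewrite size_rev size_belast.
Qed.

Definition no_short_cycle A h := forall j, j \in A -> ~ hops (A :\ j) h (a j) (b j).

Lemma no_short_cycle_sub A B h :
  A \subset B -> no_short_cycle B h -> no_short_cycle A h.
Proof.
move=> AB cB j jA /hops_sub-/(_ _ h (finset.setSD _ AB) (leqnn _)).
by apply: cB; apply: (fintype.subsetP AB).
Qed.

Lemma path_avoid A j x q z z' : path (link A) x q ->
  (z = a j /\ z' = b j) \/ (z = b j /\ z' = a j) ->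
  z' \notin x :: q -> path (link (A :\ j)) x q.
Proof.
move=> + jz; elim: q x => [|y q IH] x //= /andP[/linkP[i iA hi] pq].
rewrite !inE !negb_or => /andP[xz] /andP[yz qz].
apply/andP; split; last by apply: IH => //; rewrite inE negb_or yz.
apply/linkP; exists i => //; rewrite !inE iA andbT.
apply/eqP => ij; subst i.
by case: jz hi => [[? ?]|[? ?]] [[? ?]|[? ?]]; subst; rewrite ?eqxx in xz yz.
Qed.

(* Among the chords of a short cycle the last one inserted closes a path of
   earlier chords, so it suffices to exclude those. *)
Lemma ordered_no_short_cycle A h :
  (forall j, j \in A -> ~ hops [set i in A | i < j] h (a j) (b j)) ->
  no_short_cycle A h.
Proof.
move=> ord j jA hj.
suff key n : forall B j, j \in A -> B \subset A :\ j -> #|B| <= n ->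
   hops B h (a j) (b j) -> False by apply: (key _ _ _ jA (subxx _) (leqnn _) hj).
elim: n => [|n IH] {hj}B {jA}j jA BA Bn [q [qB ql qh]].
  have B0 : B = finset.set0 by apply/eqP; rewrite -cards_eq0 -leqn0.
  apply: (ord j jA); apply: (@hops_sub B _ h) => //; first by rewrite B0 finset.sub0set.
  by exists q.
have [lastj|] := boolP [forall i in B, i < j].
  apply: (ord j jA); apply: (@hops_sub B _ h) => //; last by exists q.
  apply/fintype.subsetP => i iB; rewrite inE (forall_inP lastj _ iB) andbT.
  by move/fintype.subsetP: BA => /(_ _ iB); rewrite inE => /andP[].
rewrite negb_forall_in => /existsP[i0 /andP[i0B i0j]].
pose k := [arg max_(i > i0 in B) (i : nat)].
have [kB kmax] : k \in B /\ forall i, i \in B -> i <= k.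
  by rewrite /k; case: arg_maxnP.
have kj : j < k.
  have : i0 <= k by apply: kmax.
  move: (fintype.subsetP BA _ kB); rewrite !inE => /andP[kj _].
  move=> i0k; rewrite ltn_neqAle val_eqE eq_sym kj; apply: leq_trans i0k.
  by rewrite leqNgt.
have [kA jk] : k \in A /\ k != j.
  by move: (fintype.subsetP BA _ kB); rewrite !inE => /andP[].
move: ql; case/shortenP: qB => q' q'B q'u q'q q'l.
have {q'q}q'h : size q' <= h.
  by apply: leq_trans qh; apply: uniq_leq_size q'q; case/andP: q'u.
move: q' q'B q'u q'l q'h => {qh}q qB qu ql qh.
have [pq|nq] := boolP (path (link (B :\ k)) (a j) q).
  apply: (IH (B :\ k) j jA); last by exists q.
    by apply: fintype.subset_trans BA; rewrite subD1set.
  by move: Bn; rewrite (cardsD1 k) kB.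
have [q1 [z [q2 [qE kz]]]] : exists q1 z q2, q = q1 ++ z :: q2 /\
   ((last (a j) q1 = a k /\ z = b k) \/ (last (a j) q1 = b k /\ z = a k)).
  elim: q (a j) qB nq {qu ql qh} => [|y q IHq] x //= /andP[xy qB].
  rewrite negb_and; have [xy'|xy' _] := boolP (link (B :\ k) x y).
    move=> /= /(IHq _ qB)[q1 [z [q2 [-> kz]]]].
    by exists (y :: q1), z, q2.
  exists [::], y, q; split => //=.
  have /linkP[i iB ii] := xy; have [ik|ik] := eqVneq i k; first by subst i.
  by case/negP: xy'; apply/linkP; exists i => //; rewrite !inE ik.
subst q; move: qB qu; rewrite -cat_cons cat_uniq cat_path.
move=> /and3P[p1 _ p2] /and3P[u1 u12 u2].
have p1' : path (link (B :\ k)) (a j) q1.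
  apply: (path_avoid p1 kz).
  by apply: contra u12 => h1; apply/hasP; exists z => //; rewrite inE eqxx.
have p2' : path (link (B :\ k)) z q2.
  apply: (@path_avoid B k z q2 z (last (a j) q1)) => //.
    by case: kz => -[-> ->]; [right|left].
  apply: contra u12 => h1; apply/hasP; exists (last (a j) q1) => //.
  by rewrite mem_last.
move: ql qh; rewrite last_cat size_cat /= => ql qh.
have sub : B :\ k \subset [set i in A | i < k].
  apply/fintype.subsetP => i; rewrite !inE => /andP[ik iB].
  move: (fintype.subsetP BA _ iB); rewrite !inE => /andP[_ ->] /=.
  by rewrite ltn_neqAle val_eqE ik kmax.
have h1 : hops [set i in A | i < k] (size q1) (a j) (last (a j) q1).
  by apply: (@hops_sub (B :\ k)) sub (leqnn _) _; exists q1.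
have h2 : hops [set i in A | i < k] (size q2) z (b j).
  by apply: (@hops_sub (B :\ k)) sub (leqnn _) _; exists q2.
have h3 : hops [set i in A | i < k] 1 (a j) (b j).
  exists [:: b j]; split => //=; rewrite andbT; apply/linkP; exists j; last by left.
  by rewrite inE jA.
have h4 := hops_cat (hops_cat (hops_sym h1) h3) (hops_sym h2).
have h5 : hops [set i in A | i < k] h (last (a j) q1) z.
  by apply: hops_sub h4; rewrite // addn1 addSnnS.
apply: (ord k kA); case: kz => -[e1 e2]; first by rewrite -e1 -e2.
by apply: hops_sym; rewrite -e1 -e2.
Qed.

Definition ball_step A (S X : {set N}) : {set N} :=
  X :|: [set y in S | [exists x in X, link A x y]].

Definition hop_ball A (S : {set N}) v n := iter n (ball_step A S) [set v].

Lemma hop_ball_sub A (S : {set N}) v n : v \in S -> hop_ball A S v n \subset S.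
Proof.
move=> vS; elim: n => [|n IH] /=; first by rewrite finset.sub1set.
by rewrite finset.subUset IH; apply/fintype.subsetP => x; rewrite inE => /andP[].
Qed.

Lemma hop_ball_mono A S v m n : m <= n -> hop_ball A S v m \subset hop_ball A S v n.
Proof.
move=> mn; rewrite -(subnK mn); elim: (n - m) => [|d IH]; first exact: subxx.
by rewrite addSn /=; apply: fintype.subset_trans IH _; apply: finset.subsetUl.
Qed.

Lemma hop_ball_path A S v n x : x \in hop_ball A S v n ->
  exists q, [/\ path (link A) v q, last v q = x, size q <= n &
     {subset v :: q <= hop_ball A S v n}].
Proof.
elim: n x => [|n IH] x /=.
  by rewrite inE => /eqP->; exists [::]; split=> // y; rewrite !inE.
have mono := fintype.subsetP (@hop_ball_mono A S v n n.+1 (leqnSn n)).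
rewrite inE => /orP[/IH[q [q1 q2 q3 q4]]|xS].
  by exists q; split => //; [exact: leqW|move=> y /q4 /mono].
have xB : x \in hop_ball A S v n.+1 by rewrite /= inE xS orbT.
move: xS; rewrite inE => /andP[_ /existsP[z /andP[/IH[q [q1 q2 q3 q4]] zx]]].
exists (rcons q x); split; rewrite ?last_rcons ?size_rcons //.
- by rewrite rcons_path q1 q2.
- move=> y; rewrite -rcons_cons mem_rcons in_cons => /orP[/eqP->//|/q4/mono//].
Qed.

Lemma hop_ball_avoid A S v n x j y z : x \in hop_ball A S v n.+1 ->
  y \notin hop_ball A S v n -> x != y ->
  (z = a j /\ y = b j) \/ (z = b j /\ y = a j) -> hops (A :\ j) n.+1 v x.
Proof.
rewrite /= inE => /orP[/hop_ball_path[q [q1 q2 q3 q4]]|].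
  move=> yB xy jzy; exists q; split => //; last exact: leqW.
  by apply: path_avoid q1 jzy _; apply: contra yB => /q4.
rewrite inE => /andP[_ /existsP[t /andP[/hop_ball_path[q [q1 q2 q3 q4]] tx]]].
move=> yB xy jzy; exists (rcons q x); rewrite last_rcons size_rcons; split => //.
apply: path_avoid jzy _; first by rewrite rcons_path q1 q2.
rewrite -rcons_cons mem_rcons in_cons negb_or eq_sym xy.
by apply: contra yB => /q4.
Qed.

Lemma card_near_ball A (S : {set N}) v r : no_short_cycle A (2 * r + 3) -> v \in S ->
  (forall j, j \in A -> a j \in S /\ b j \in S) -> forall n, n <= r ->
  #|[set j in A | (a j \in hop_ball A S v n) || (b j \in hop_ball A S v n)]|
    <= #|hop_ball A S v n.+1|.
Proof.
move=> ncA vS AS n nr; set C := finset _; pose Bl := hop_ball A S v.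
have monoB m k x : m <= k -> x \in Bl m -> x \in Bl k.
  by move=> /(hop_ball_mono A S v)/fintype.subsetP; apply.
pose far j := if [exists m : 'I_n.+2, (a j \in Bl m) && (b j \notin Bl m)] then b j else a j.
pose oth j := if [exists m : 'I_n.+2, (a j \in Bl m) && (b j \notin Bl m)] then a j else b j.
have ends j : (oth j = a j /\ far j = b j) \/ (oth j = b j /\ far j = a j).
  by rewrite /far /oth; case: ifP; [left|right].
have farP j m : m <= n.+1 -> far j \in Bl m -> oth j \in Bl m.
  rewrite -ltnS => mn; rewrite /far /oth; case: ifP => [/existsP[k /andP[ak bk]] bm|].
    have [km|mk] := leqP k m; first exact: monoB ak.
    by case/negP: bk; apply: monoB bm; apply: ltnW.
  move=> /negbT; rewrite negb_exists => /forallP/(_ (Ordinal mn)) /=.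
  by rewrite negb_and negbK => /orP[/negbTE->|->].
have inB j : j \in C -> a j \in Bl n.+1 /\ b j \in Bl n.+1.
  rewrite inE => /andP[jA jB]; have [aS bS] := AS j jA.
  have lk : link A (a j) (b j) by apply/linkP; exists j => //; left.
  case/orP: jB => jB; split; rewrite /Bl /= !inE ?jB //; apply/orP; right.
    by rewrite bS; apply/existsP; exists (a j); rewrite jB.
  by rewrite aS; apply/existsP; exists (b j); rewrite jB link_sym.
have CA j : j \in C -> j \in A by rewrite inE => /andP[].
have noloop j : j \in A -> oth j != far j.
  move=> jA; apply/eqP => e; apply: (ncA j jA); exists [::]; split => //=.
  by case: (ends j) e => -[-> ->].
have -> : #|C| = #|far @: C|.
  rewrite card_in_imset // => j j' jC j'C ff; apply/eqP; apply: contraT => jj'.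
  have [jA j'A] := (CA _ jC, CA _ j'C).
  have fB : far j \in Bl n.+1.
    by have [? ?] := inB _ jC; case: (ends j) => -[_ ->].
  have exm : exists m, far j \in Bl m by exists n.+1.
  pose m := ex_minn exm; have mn : m <= n.+1 by rewrite /m; case: ex_minnP => k _; apply.
  have fm : far j \in Bl m by rewrite /m; case: ex_minnP.
  have mmin k : far j \in Bl k -> m <= k by rewrite /m; case: ex_minnP => i _; apply.
  clearbody m.
  case: m => [|m] in mn fm mmin *.
    have := noloop _ jA; have := farP _ _ mn fm; move: fm.
    by rewrite /Bl /= !inE => /eqP-> /eqP->; rewrite eqxx.
  have fnm : far j \notin Bl m by apply/negP => /mmin; rewrite ltnn.
  have ox := farP _ _ mn fm; have ox' : oth j' \in Bl m.+1 by apply: farP; rewrite -?ff.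
  have h1 : hops (A :\ j) m.+1 v (oth j).
    exact: hop_ball_avoid ox fnm (noloop _ jA) (ends j).
  have h2 : hops (A :\ j) m.+1 v (oth j').
    by apply: hop_ball_avoid ox' fnm _ (ends j); rewrite ff noloop.
  have h3 : hops (A :\ j) 1 (oth j') (far j).
    exists [:: far j]; split => //=; rewrite andbT; apply/linkP; exists j'.
      by rewrite !inE eq_sym jj'.
    by rewrite ff; apply: ends.
  have h4 := hops_cat (hops_cat (hops_sym h1) h2) h3.
  have h5 : hops (A :\ j) (2 * r + 3) (oth j) (far j).
    by apply: hops_sub h4; rewrite ?subxx //; move: mn nr; clear; lia.
  exfalso; apply: (ncA j jA).
  by case: (ends j) h5 => -[-> ->] // /hops_sym.
apply: subset_leq_card; apply/fintype.subsetP => _ /imsetP[j jC ->].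
by have [? ?] := inB _ jC; case: (ends j) => -[_ ->].
Qed.

(* Ball growing: some ball at most doubles at its next step, so deleting it
   removes at most twice as many chords as vertices. *)
Lemma moore_bound A (S : {set N}) r : no_short_cycle A (2 * r + 3) ->
  (forall j, j \in A -> a j \in S /\ b j \in S) -> #|S| <= 2 ^ r ->
  #|A| <= 2 * #|S|.
Proof.
elim: {S}_.+1 {-2}S (ltnSn #|S|) A => // n IH S Sn A ncA AS Sr.
have [->|[j0 j0A]] := set_0Vmem A; first by rewrite cards0.
have [vS _] := AS _ j0A; set v := a j0 in vS; pose Bl := hop_ball A S v.
have [i ir Bi] : exists2 i, i <= r & #|Bl i.+1| <= 2 * #|Bl i|.
  have [/existsP[i Bi]|no] := boolP [exists i : 'I_r.+1, #|Bl i.+1| <= 2 * #|Bl i|].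
    by exists i => //; rewrite -ltnS.
  have grow i : i <= r.+1 -> 2 ^ i <= #|Bl i|.
    elim: i => [|i IHi] ir; first by rewrite expn0 cards1.
    move: no; rewrite negb_exists => /forallP/(_ (Ordinal ir)) /=.
    rewrite -ltnNge => /ltnW; apply: leq_trans; rewrite expnS leq_mul2l /=.
    by apply: IHi; apply: ltnW.
  have := grow _ (leqnn _); rewrite expnS.
  have := subset_leq_card (@hop_ball_sub A S v r.+1 vS).
  have : 0 < 2 ^ r by rewrite expn_gt0.
  rewrite -/Bl; lia.
pose C := [set j in A | (a j \in Bl i) || (b j \in Bl i)].
have CB : #|C| <= #|Bl i.+1| by apply: (card_near_ball (r := r)).
have BS : Bl i \subset S by apply: hop_ball_sub.
have vB : v \in Bl i by apply: (fintype.subsetP (@hop_ball_mono A S v 0 i _)); rewrite ?inE.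
have cS : #|S| = #|Bl i| + #|S :\: Bl i|.
  by rewrite -(cardsID (Bl i) S) (finset.setIidPr BS).
have cA : #|A| = #|C| + #|A :\: C|.
  by rewrite -(cardsID C A) (finset.setIidPr _) //; apply/fintype.subsetP => j; rewrite inE => /andP[].
have B0 : 0 < #|Bl i| by apply/card_gt0P; exists v.
have : #|A :\: C| <= 2 * #|S :\: Bl i|.
  apply: IH.
  - by lia.
  - by apply: no_short_cycle_sub ncA; apply: finset.subsetDl.
  - move=> j; rewrite !inE => /andP[]; case jA: (j \in A) => //= + _.
    rewrite negb_or => /andP[-> ->]; exact: AS.
  - by apply: leq_trans Sr; rewrite cS; lia.
lia.
Qed.

End Moore.

(** * Clusterings and one merging step *)

(* [D x y r] reads: the distance from [x] to [y] is at most [r]. *)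
Record dist_rel (R : realType) (X : Type) (D : X -> X -> R -> Prop) : Prop := DistRel {
  dist_refl : forall x, D x x 0;
  dist_sym : forall x y r, D x y r -> D y x r;
  dist_trans : forall x y z r q, D x y r -> D y z q -> D x z (r + q);
  dist_le : forall x y r q, D x y r -> r <= q -> D x y q }.

Section Clusterings.
Variables (R : realType) (U : finType).
Implicit Types (D : U -> U -> R -> Prop) (p g : U -> U) (f : U -> R) (u s t : R).

Definition labels p : {set U} := [set p a | a : U].

Definition mass p f g (X : U) : R := \sum_(l in labels p | g l == X) f l.

Definition volume p f : R := \sum_(l in labels p) f l.

(* [f] bounds the diameters with a margin [u], so that two clusters containing
   points at distance [u] form a cluster whose bound is the sum of theirs. *)
Definition clustering D u p f := forall a b, p a = p b -> D a b (f (p a) - u).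

Lemma mem_labels p a : p a \in labels p.
Proof. exact: imset_f. Qed.

Lemma labelsP p l : l \in labels p -> exists a, l = p a.
Proof. by case/imsetP => a _ ->; exists a. Qed.

Lemma mass_comp p f g c X : mass (g \o p) (mass p f g) c X = mass p f (c \o g) X.
Proof.
rewrite /mass [RHS](partition_big g (fun P => (P \in labels (g \o p)) && (c P == X))).
  apply: eq_bigr => P /andP[_ /eqP cX]; apply: eq_bigl => l.
  by rewrite -andbA; congr andb => /=; have [->|] := eqVneq (g l) P; rewrite ?cX ?eqxx ?andbF.
move=> l /= /andP[/labelsP[a ->] ->]; rewrite andbT; exact: (mem_labels (g \o p)).
Qed.

Lemma volume_mass p f g : volume (g \o p) (mass p f g) = volume p f.
Proof.
rewrite /volume [RHS](partition_big g (fun P => P \in labels (g \o p))) //.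
by move=> l /labelsP[a ->]; exact: (mem_labels (g \o p)).
Qed.

Lemma mass_ge0 p f g X : (forall a, 0 <= f (p a)) -> 0 <= mass p f g X.
Proof. by move=> f0; apply: sumr_ge0 => l /andP[/labelsP[a ->] _]. Qed.

Lemma mass_id p f a : mass p f id (p a) = f (p a).
Proof.
rewrite /mass (big_pred1 (p a)) // => l /=.
by case: eqP => [->|_]; rewrite ?mem_labels ?andbF.
Qed.

End Clusterings.

Section Merging.
Variables (R : realType) (U : finType) (D : U -> U -> R -> Prop) (u : R).
Variable touch : rel U.
Hypothesis HD : dist_rel D.
Hypothesis touchD : forall a b, touch a b -> D a b u.

Lemma clustering_touch (p : U -> U) (f : U -> R) a b a' b' :
  clustering D u p f -> touch a b -> p a' = p a -> p b' = p b ->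
  D a' b' (f (p a) + f (p b) - u).
Proof.
move=> cl ab ea eb.
have h1 := cl _ _ ea; have h2 := cl _ _ (esym eb).
have := dist_trans HD (dist_trans HD h1 (touchD ab)) h2; rewrite ea.
by move/(dist_le HD); apply; lra.
Qed.

Lemma merge_small (p : U -> U) (f : U -> R) (r : R) :
  (forall a, 0 <= f (p a) < 2 * r) -> clustering D u p f ->
  exists g, [/\ clustering D u (g \o p) (mass p f g),
    forall a, mass p f g (g (p a)) < 2 * r &
    forall a b, touch a b -> g (p a) <> g (p b) ->
      r <= mass p f g (g (p a)) \/ r <= mass p f g (g (p b))].
Proof.
move=> f0 cl.
have fp a : 0 <= f (p a) by case/andP: (f0 a).
suff key n : forall g, (#|labels (g \o p)| <= n)%N -> clustering D u (g \o p) (mass p f g) ->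
    (forall a, mass p f g (g (p a)) < 2 * r) ->
  exists g, [/\ clustering D u (g \o p) (mass p f g),
    forall a, mass p f g (g (p a)) < 2 * r &
    forall a b, touch a b -> g (p a) <> g (p b) ->
      r <= mass p f g (g (p a)) \/ r <= mass p f g (g (p b))].
  apply: (key _ id (leqnn _)).
    by move=> a b /= e; rewrite mass_id; apply: cl.
  by move=> a; rewrite mass_id; case/andP: (f0 a).
elim: n => [|n IH] g.
  rewrite leqn0 cards_eq0 => /eqP e _ _; exists g; split => // a; exfalso;
    by have := mem_labels (g \o p) a; rewrite e inE.
move=> gn clg gr.
have [[a [b [ab gab ma mb]]]|no] := pselect (exists a b, [/\ touch a b, g (p a) <> g (p b),
    mass p f g (g (p a)) < r & mass p f g (g (p b)) < r]); last first.
  exists g; split => // a b ab gab; have [h|h] := leP r (mass p f g (g (p a))); first by left.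
  right; have [//|h'] := leP r (mass p f g (g (p b))); case: no; by exists a, b.
set P1 := g (p a) in gab ma; set P2 := g (p b) in gab mb.
have P12 : P1 != P2 by apply/eqP.
pose g' l := if g l == P2 then P1 else g l.
have gP1 l : (g' l == P1) = (g l == P1) || (g l == P2).
  by rewrite /g'; case: (eqVneq (g l) P2) => _; rewrite ?eqxx ?orbT ?orbF.
have m1 : mass p f g' P1 = mass p f g P1 + mass p f g P2.
  rewrite /mass (bigID (fun l => g l == P1)) /=; congr (_ + _); apply: eq_bigl => l;
    rewrite gP1 -andbA; congr andb.
    by case: (g l == P1); rewrite ?andbF.
  have [->|_] := eqVneq (g l) P1; last by rewrite /= andbT.
  by rewrite (negbTE P12).
have m2 X : X != P1 -> X != P2 -> mass p f g' X = mass p f g X.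
  move=> X1 X2; apply: eq_bigl => l; congr andb; rewrite /g'.
  by case: (eqVneq (g l) P2) => [->|//]; rewrite eq_sym (negbTE X1) eq_sym (negbTE X2).
have nP2 c : g' (p c) != P2.
  by rewrite /g'; case: ifP => // /negbT.
have nP1 c : g' (p c) != P1 -> g (p c) = g' (p c).
  by rewrite /g'; case: ifP; rewrite ?eqxx.
apply: (IH g').
- rewrite -ltnS; apply: leq_trans gn; apply: proper_card; apply/properP; split.
    apply/fintype.subsetP => X /labelsP[c ->] /=; rewrite /g'; case: ifP => _; exact: (mem_labels (g \o p)).
  exists P2; first exact: (mem_labels (g \o p)).
  by apply/negP => /labelsP[c] /eqP; rewrite eq_sym (negbTE (nP2 c)).
- move=> c d /= cd; have [e|ne] := eqVneq (g' (p c)) P1; last first.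
    by rewrite m2 // -nP1 //; apply: clg => /=; rewrite !nP1 // -cd.
  have M1 : 0 <= mass p f g P1 by apply: mass_ge0.
  have M2 : 0 <= mass p f g P2 by apply: mass_ge0.
  rewrite e m1; move/eqP: (e); rewrite gP1; move/eqP: (e); rewrite cd gP1.
  case/orP=> /eqP dP; case/orP => /eqP cP.
  + have := clg c d; rewrite /= cP dP => /(_ erefl) h; apply: dist_le h _ => //; lra.
  + apply: (dist_sym HD); apply: (clustering_touch clg ab) => //.
  + by apply: (clustering_touch clg ab).
  + have := clg c d; rewrite /= cP dP => /(_ erefl) h; apply: dist_le h _ => //; lra.
- move=> c; have [e|ne] := eqVneq (g' (p c)) P1; last by rewrite m2 // -nP1.
  by rewrite e m1; lra.
Qed.

Hypothesis touch_conn : forall A : {set U}, A != finset.set0 -> A != [set: U] ->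
  exists a b, [/\ a \in A, b \notin A & touch a b].

Lemma attach_small (p : U -> U) (f : U -> R) (r : R) : 0 <= r ->
  (forall a, 0 <= f (p a) < 2 * r) -> clustering D u p f ->
  (forall a b, touch a b -> p a <> p b -> r <= f (p a) \/ r <= f (p b)) ->
  (exists a b, p a <> p b) ->
  exists c, (forall a, r <= mass p f c (c (p a))) /\
    forall a b, c (p a) = c (p b) ->
      D a b (mass p f c (c (p a)) - u) /\ D a b (4 * r - u).
Proof.
move=> r0 f0 cl nosmall [a0 [b0 ab0]].
have fp a : 0 <= f (p a) by case/andP: (f0 a).
pose big P X := [&& X \in labels p, r <= f X & [exists a, [exists b,
   [&& touch a b, p a == P & p b == X]]]].
pose c P := if r <= f P then P else odflt P [pick X | big P X].
have cbig P : r <= f P -> c P = P by rewrite /c => ->.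
have key a : r <= f (c (p a)) /\ (exists d, c (p a) = p d) /\ ((c (p a) = p a) \/
   [/\ c (p a) <> p a, f (p a) < r & exists d, p d = c (p a) /\ D a d (f (p a))]).
  have [h|h] := leP r (f (p a)); first by rewrite cbig //; split => //; split; [exists a|left].
  have [X /and3P[XL rX /existsP[d /existsP[e /and3P[de /eqP dP /eqP eX]]]]] : exists X, big (p a) X.
    pose A := [set b | p b == p a].
    have A1 : A != finset.set0 by apply/finset.set0Pn; exists a; rewrite inE.
    have A2 : A != [set: U].
      apply/eqP => AT; apply: ab0.
      have : a0 \in A by rewrite AT inE.
      have : b0 \in A by rewrite AT inE.
      by rewrite !inE => /eqP-> /eqP->.
    have [d [e []]] := touch_conn A1 A2; rewrite !inE => /eqP dA /eqP eA de.
    exists (p e); rewrite /big mem_labels /=; apply/andP; split.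
      case: (nosmall _ _ de); rewrite ?dA //; first by move=> ea; apply: eA.
      by move=> ?; lra.
    by apply/existsP; exists d; apply/existsP; exists e; rewrite de dA !eqxx.
  have hc : (r <= f (p a)) = false by rewrite leNgt h.
  rewrite /c hc /=; case: pickP => [Y|/(_ X)]; last first.
    rewrite /big XL rX; move/negbT/negP; case; apply/existsP; exists d; apply/existsP; exists e.
    by rewrite de dP eX !eqxx.
  move=> /and3P[/labelsP[y ->] rY /existsP[d' /existsP[e' /and3P[de' /eqP dP' /eqP eX']]]] /=.
  split => //; split; first by exists y.
  right; split => //; first by move=> e1; move: rY; rewrite e1; lra.
  exists e'; split => //.
  have := dist_trans HD (cl _ _ (esym dP')) (touchD de'); move/(dist_le HD); apply.
  by lra.
have massge a b : c (p a) = c (p b) -> p a <> p b -> c (p a) <> p a -> c (p a) <> p b ->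
   f (p a) + f (p b) + f (c (p a)) <= mass p f c (c (p a)).
  move=> cab ab ca cb; have [rX [[d dX] _]] := key a.
  rewrite /mass (bigD1 (c (p a))) /=; last first.
    by rewrite (cbig _ rX) eqxx andbT dX mem_labels.
  rewrite (bigD1 (p a)) /=; last by rewrite mem_labels eqxx /=; apply/eqP => /esym.
  rewrite (bigD1 (p b)) /=; last first.
    rewrite mem_labels cab eqxx /= -cab; apply/andP; split; apply/eqP => /esym //.
  set S := (\sum_(i | _) f i); suff : 0 <= S by lra.
  by apply: sumr_ge0 => l /andP[/andP[/andP[/andP[/labelsP[z ->]]]]].
have massge2 a : c (p a) <> p a -> f (p a) + f (c (p a)) <= mass p f c (c (p a)).
  move=> ca; have [rX [[d dX] _]] := key a.
  rewrite /mass (bigD1 (c (p a))) /=; last first.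
    by rewrite (cbig _ rX) eqxx andbT dX mem_labels.
  rewrite (bigD1 (p a)) /=; last by rewrite mem_labels eqxx /=; apply/eqP => /esym.
  set S := (\sum_(i | _) f i); suff : 0 <= S by lra.
  by apply: sumr_ge0 => l /andP[/andP[/andP[/labelsP[z ->]]]].
have massge1 a : f (c (p a)) <= mass p f c (c (p a)).
  have [rX [[d dX] _]] := key a.
  rewrite /mass (bigD1 (c (p a))) /=; last first.
    by rewrite (cbig _ rX) eqxx andbT dX mem_labels.
  rewrite lerDl.
  by apply: sumr_ge0 => l /andP[/andP[/labelsP[z ->]]].
exists c; split.
  by move=> a; have [rX _] := key a; apply: le_trans rX (massge1 a).
move=> a b cab.
suff [q h2 [h3 h4]] : exists2 q, D a b (q - u) & q <= mass p f c (c (p a)) /\ q <= 4 * r.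
  by split; apply: dist_le h2 _ => //; lra.
have [/andP[fa0 fa] /andP[fb0 fb]] := (f0 a, f0 b).
have [rX [[x dX] ka]] := key a; have [_ [_ kb]] := key b.
have /andP[fx0 fx] := f0 x; have fX : f (c (p a)) < 2 * r by rewrite dX.
have ma := massge1 a.
have [ab|ab] := pselect (p a = p b).
  exists (f (p a)); first exact: cl.
  by split; last lra; case: ka => [e|[/massge2 h _ _]]; [move: ma; rewrite e|lra].
case: ka => [ea|[na fra [d [pd Dd]]]]; case: kb => [eb|[nb frb [e [pe De]]]].
- by case: ab; rewrite -ea cab.
- exists (f (p b) + f (c (p a))); last first.
    by split; last lra; have := massge2 b nb; rewrite -cab; lra.
  have h : D a e (f (p a) - u) by apply: cl; rewrite pe -cab ea.
  have := dist_trans HD h (dist_sym HD De); move/(dist_le HD); apply.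
  by rewrite ea; lra.
- exists (f (p a) + f (c (p a))); last by split; [exact: massge2|lra].
  have h : D d b (f (p d) - u) by apply: cl; rewrite pd cab eb.
  have := dist_trans HD Dd h; move/(dist_le HD); apply.
  by rewrite pd; lra.
- exists (f (p a) + f (p b) + f (c (p a))).
    have h : D d e (f (p d) - u) by apply: cl; rewrite pd pe cab.
    have := dist_trans HD (dist_trans HD Dd h) (dist_sym HD De); move/(dist_le HD); apply.
    by rewrite pd; lra.
  split; last lra.
  by apply: massge => // e1; apply: nb; rewrite -cab.
Qed.

End Merging.

Section LevelStep.
Variables (R : realType) (U : finType) (M : nat) (x y : 'I_M -> U).
Variables (J : {set 'I_M}) (D : U -> U -> R -> Prop) (Dj : 'I_M -> U -> U -> R -> Prop).
Variables (u s t r : R) (n : nat).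
Hypothesis HD : dist_rel D.
Hypothesis HDj : forall j, j \in J -> dist_rel (Dj j).
Hypothesis DDj : forall j a b q, j \in J -> D a b q -> Dj j a b q.
Hypothesis earlier : forall i j, i \in J -> j \in J -> (i < j)%N ->
  Dj j (x i) (y i) (4 * s).
Hypothesis stretched : forall j, j \in J -> ~ Dj j (x j) (y j) (t * s).
Hypothesis u0 : 0 <= u.
Hypothesis s0 : 0 < s.
Hypothesis sr : s <= r.
Hypothesis Un : (#|U| <= 2 ^ n)%N.
Hypothesis tn : 10 * n%:R + 16 <= t.
Hypothesis tr : 8 * r + 4 * s <= t * s.

Definition active (p : U -> U) : {set U} :=
  [set l in labels p | [exists j in J, (p (x j) == l) || (p (y j) == l)]].

Lemma hops_dist (p : U -> U) (f : U -> R) (j : 'I_M) : clustering D u p f ->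
  (forall a, f (p a) <= s) -> j \in J ->
  forall q l a b, path (link (p \o x) (p \o y) [set i in J | (i < j)%N]) l q ->
    p a = l -> p b = last l q -> Dj j a b (s + (size q)%:R * (5 * s)).
Proof.
move=> cl fs jJ; elim=> [|l' q IH] l a b /=.
  move=> _ al bl; apply: (dist_le (HDj jJ) (DDj jJ (cl a b _))); first by rewrite al bl.
  by rewrite mul0r; have := fs a; move: u0; lra.
move=> /andP[/linkP[i + li] pq] al bl; rewrite inE => /andP[iJ ij].
have [c [d [cl' dl cd]]] : exists c d, [/\ p c = l, p d = l' & Dj j c d (4 * s)].
  case: li => -[-> ->]; first by exists (x i), (y i); split => //; apply: earlier.
  by exists (y i), (x i); split => //; apply: (dist_sym (HDj jJ)); apply: earlier.
have h1 : Dj j a c (f (p a) - u) by apply: DDj => //; apply: cl; rewrite al cl'.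
have h2 := IH l' d b pq dl bl.
apply: (dist_le (HDj jJ) (dist_trans (HDj jJ) (dist_trans (HDj jJ) h1 cd) h2)).
by rewrite -natr1; have := fs a; move: u0; lra.
Qed.

Lemma card_chords (p : U -> U) (f : U -> R) : clustering D u p f ->
  (forall a, f (p a) <= s) -> (#|J| <= 2 * #|active p|)%N.
Proof.
move=> cl fs.
apply: (@moore_bound U M (p \o x) (p \o y) J (active p) n).
- apply: ordered_no_short_cycle => j jJ [q [qp ql qs]].
  apply: (stretched jJ).
  apply: (dist_le (HDj jJ) (hops_dist cl fs jJ qp erefl (esym ql))).
  have : (size q)%:R <= 2 * n%:R + 3 :> R.
    by rewrite -natrM -natrD ler_nat.
  by move=> h; move: s0 tn h; nra.
- move=> j jJ; rewrite !inE !mem_labels /=; split; apply/existsP; exists j;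
    by rewrite jJ eqxx ?orbT.
- by apply: leq_trans Un; rewrite max_card.
Qed.

Section Superclusters.
Variables (p G : U -> U).
Let sg := G \o p.
Hypothesis wide : forall a b, sg a = sg b -> D a b (4 * r - u).

Definition nb X : {set U} := [set Y | link (sg \o x) (sg \o y) J X Y].

Lemma wide4 a b : sg a = sg b -> D a b (4 * r).
Proof. by move=> e; apply: (dist_le HD (wide e)); move: u0; lra. Qed.

Lemma chord_neq j : j \in J -> sg (x j) <> sg (y j).
Proof.
move=> jJ e; apply: (stretched jJ); apply: (dist_le (HDj jJ) (DDj jJ (wide4 e))).
by move: s0 tr sr; lra.
Qed.

Definition joins j X Y := (sg (x j) = X /\ sg (y j) = Y) \/ (sg (y j) = X /\ sg (x j) = Y).

Lemma joins_inj i j X Y : i \in J -> j \in J -> joins i X Y -> joins j X Y -> i = j.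
Proof.
wlog ij : i j / (i < j)%N.
  move=> H iJ jJ iX jX; case: (ltngtP i j) => [h|h|/val_inj //].
    exact: H h iJ jJ iX jX.
  by apply/esym/(H _ _ h).
move=> iJ jJ iX jX; exfalso; apply: (stretched jJ).
have W a b : sg a = sg b -> Dj j a b (4 * r) by move=> /wide4 /(DDj jJ).
have e := earlier iJ jJ ij; have H := HDj jJ; have e' := dist_sym H e.
have h : 4 * r + 4 * s + 4 * r <= t * s by move: tr; lra.
case: iX => -[i1 i2]; case: jX => -[j1 j2].
- by apply: (dist_le H (dist_trans H (dist_trans H (W _ _ _) e) (W _ _ _)) h); rewrite ?i1 ?i2.
- by apply: (dist_le H (dist_trans H (dist_trans H (W _ _ _) e') (W _ _ _)) h); rewrite ?i1 ?i2.
- by apply: (dist_le H (dist_trans H (dist_trans H (W _ _ _) e') (W _ _ _)) h); rewrite ?i1 ?i2.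
- by apply: (dist_le H (dist_trans H (dist_trans H (W _ _ _) e) (W _ _ _)) h); rewrite ?i1 ?i2.
Qed.

Lemma card_nb X : (#|[set l in active p | G l == X]| <= #|nb X|)%N.
Proof.
pose P l Y := [exists j in J, ((p (x j) == l) && (sg (y j) == Y)) ||
                              ((p (y j) == l) && (sg (x j) == Y))].
pose h l := odflt X [pick Y | P l Y].
have hP l : l \in active p -> P l (h l).
  rewrite inE => /andP[_ /existsP[j /andP[jJ jl]]].
  rewrite /h; case: pickP => //= no; exfalso.
  case/orP: jl => jl; [move: (no (sg (y j)))|move: (no (sg (x j)))] => /negbT/negP; case;
    by apply/existsP; exists j; rewrite jJ jl !eqxx ?orbT.
rewrite -(card_in_imset (f := h) (D := [set l in active p | G l == X])).
  apply: subset_leq_card; apply/fintype.subsetP => _ /imsetP[l + ->].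
  rewrite inE => /andP[/hP/existsP[j /andP[jJ jl]] /eqP GX]; rewrite inE; apply/linkP.
  exists j => //; rewrite /= -GX; case/orP: jl => /andP[/eqP<- /eqP<-]; by [left|right].
move=> l l'; rewrite !inE -!/(active p) => /andP[lA /eqP lX] /andP[l'A /eqP l'X] hh.
have {}lA : l \in active p by rewrite inE.
have {}l'A : l' \in active p by rewrite inE.
have /existsP[j /andP[jJ jl]] := hP _ lA; have /existsP[i /andP[iJ il]] := hP _ l'A.
have jX : joins j X (h l).
  by rewrite -lX; case/orP: jl => /andP[/eqP<- /eqP<-]; [left|right].
have iX : joins i X (h l).
  by rewrite hh -l'X; case/orP: il => /andP[/eqP<- /eqP<-]; [left|right].
have ji := joins_inj jJ iJ jX iX; subst i.
case/orP: jl => /andP[/eqP e1 /eqP e2]; case/orP: il => /andP[/eqP e3 /eqP e4].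
- by rewrite -e1 -e3.
- by case: (chord_neq jJ); rewrite e2 e4 hh.
- by case: (chord_neq jJ); rewrite e2 e4 hh.
- by rewrite -e1 -e3.
Qed.

Definition rich X := (72 <= #|[set l in active p | G l == X]|)%N.
Definition cnb X : {set U} := X |: nb X.

Lemma cnb_sym X Y : (X \in cnb Y) = (Y \in cnb X).
Proof. by rewrite !inE eq_sym link_sym. Qed.

(* [S] is a maximal packing by closed neighbourhoods of rich vertices. *)
Lemma centres : exists S : {set U}, exists c : U -> U,
  [/\ forall X, X \in S -> rich X,
      forall X Y, X \in S -> Y \in cnb X -> c Y = X,
      forall Y, rich Y -> c Y \in S,
      forall Y, c Y \notin S -> c Y = Y &
      forall Y, c Y \in S -> exists Z, Z \in cnb Y /\ Z \in cnb (c Y)].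
Proof.
pose good (S : {set U}) := [forall X in S, rich X] &&
  [forall X in S, forall Y in S, (X != Y) ==> [disjoint cnb X & cnb Y]].
have g0 : good finset.set0.
  by apply/andP; split; apply/forall_inP => X; rewrite inE.
have [S /maxsetP[gS Smax] _] := maxset_exists g0.
move/andP: (gS) => [/forall_inP Srich /forall_inP Sdis].
have Suniq X X' Y : X \in S -> X' \in S -> Y \in cnb X -> Y \in cnb X' -> X = X'.
  move=> XS X'S YX YX'; apply/eqP; apply: contraT => XX'.
  have /forall_inP/(_ _ X'S) := Sdis _ XS; rewrite XX' /= => /pred0P/(_ Y) /=.
  by rewrite YX YX'.
pose c Y := if [pick X in S | Y \in cnb X] is Some X then X else
  if rich Y then odflt Y [pick X in S | ~~ [disjoint cnb Y & cnb X]] else Y.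
have cS X Y : X \in S -> Y \in cnb X -> c Y = X.
  move=> XS YX; rewrite /c; case: pickP => [X' /andP[X'S YX']|/(_ X)]; last by rewrite /= XS YX.
  exact: Suniq YX' YX.
have crich Y : rich Y -> (c Y \in S) /\ exists Z, Z \in cnb Y /\ Z \in cnb (c Y).
  move=> rY; rewrite /c; case: pickP => [X /andP[XS YX]|no1].
    by split => //; exists Y; rewrite YX inE finset.set11.
  rewrite rY; case: pickP => [X /andP[XS]|no2] /=.
    by move=> /pred0Pn[Z /andP[ZY ZX]]; split => //; exists Z.
  suff gY : good (Y |: S).
    have YS : Y |: S = S by apply: Smax => //; apply: finset.subsetUr.
    have : Y \in S by rewrite -YS !inE eqxx.
    by move=> YS'; have := no1 Y; rewrite /= YS' /= !inE eqxx.
  have dis X : X \in S -> [disjoint cnb Y & cnb X].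
    by move=> XS; apply: contraT => h; have := no2 X; rewrite /= XS h.
  apply/andP; split; apply/forall_inP => X; rewrite !inE => /orP[/eqP->//|XS].
  - exact: Srich.
  - apply/forall_inP => X'; rewrite !inE => /orP[/eqP->|X'S]; first by rewrite eqxx.
    by rewrite dis ?implybT.
  - apply/forall_inP => X'; rewrite !inE => /orP[/eqP->|X'S].
      by rewrite disjoint_sym dis ?implybT.
    by have /forall_inP := Sdis _ XS; apply.
exists S, c; split => //.
- by move=> Y /crich[].
- move=> Y; rewrite /c; case: pickP => [X /andP[XS YX]|no1]; first by rewrite XS.
  case: ifP => // rY; case: pickP => [X /andP[XS _]|//] /=; by rewrite XS.
- move=> Y; have [/crich[]//|nr] := boolP (rich Y).
  rewrite /c; case: pickP => [X /andP[XS YX] _|no1].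
    by exists Y; rewrite YX inE finset.set11.
  by rewrite (negbTE nr) => YS; have := no1 Y; rewrite /= YS /= !inE eqxx.
Qed.

End Superclusters.

Variables (D' : U -> U -> R -> Prop) (touch : rel U).
Hypothesis HD' : dist_rel D'.
Hypothesis DD' : forall a b q, D a b q -> D' a b q.
Hypothesis chordsD' : forall j, j \in J -> D' (x j) (y j) (4 * s).
Hypothesis touchD : forall a b, touch a b -> D a b u.
Hypothesis touch_conn : forall A : {set U}, A != finset.set0 -> A != [set: U] ->
  exists a b, [/\ a \in A, b \notin A & touch a b].

Lemma no_chords (p : U -> U) (f : U -> R) : (forall a b, p a = p b) ->
  (forall a, f (p a) <= 2 * r) -> clustering D u p f -> #|J| = 0%N.
Proof.
move=> cst fr cl; apply/eqP; rewrite cards_eq0; apply/set0Pn => -[j jJ].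
apply: (stretched jJ); apply: (dist_le (HDj jJ) (DDj jJ (cl _ _ (cst _ _)))).
by have := fr (x j); move: u0 s0 sr tr; lra.
Qed.

Section Assembly.
Variables (p G : U -> U) (f : U -> R) (S : {set U}) (cen : U -> U).
Hypothesis f0 : forall a, 0 <= f (p a) <= s.
Hypothesis fs : forall a, s <= 64 * f (p a).
Hypothesis clf : clustering D u p f.
Hypothesis wideG : forall a b, (G \o p) a = (G \o p) b -> D a b (4 * r - u).
Hypothesis massG : forall a, r <= mass p f G (G (p a)).
Hypothesis clG : clustering D u (G \o p) (mass p f G).
Hypothesis Srich : forall X, X \in S -> rich p G X.
Hypothesis cenS : forall X Y, X \in S -> Y \in cnb p G X -> cen Y = X.
Hypothesis richS : forall Y, rich p G Y -> cen Y \in S.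
Hypothesis cen_id : forall Y, cen Y \notin S -> cen Y = Y.
Hypothesis cen_hop : forall Y, cen Y \in S ->
  exists Z, Z \in cnb p G Y /\ Z \in cnb p G (cen Y).

Let r0 : 0 < r. Proof. exact: lt_le_trans s0 sr. Qed.
Let fp a : 0 <= f (p a). Proof. by case/andP: (f0 a). Qed.

Definition merged_bound X := if X \in S then 36 * r else Num.min (mass p f G X) (4 * r).

Lemma hop_dist a Z : Z \in cnb p G (G (p a)) ->
  exists q, G (p q) = Z /\ D' a q (4 * r + 4 * s).
Proof.
have W c d : G (p c) = G (p d) -> D' c d (4 * r).
  by move=> e; apply: DD'; apply: (dist_le HD (wideG e)); move: u0; lra.
rewrite inE => /orP[|].
  rewrite inE => /eqP->; exists a; split => //; apply: (dist_le HD' (dist_refl HD' a)).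
  by move: r0 s0; lra.
rewrite inE => /linkP[j jJ [] [/= e1 e2]].
  by exists (y j); split => //; apply: (dist_trans HD' (W _ _ e1) (chordsD' jJ)).
exists (x j); split => //; apply: (dist_trans HD' (W _ _ e1)).
exact: dist_sym HD' _ _ _ (chordsD' jJ).
Qed.

Lemma centre_dist a : cen (G (p a)) \in S ->
  exists q, G (p q) = cen (G (p a)) /\ D' a q (8 * r + 8 * s).
Proof.
move=> /cen_hop[Z [Z1 Z2]]; have [q [qZ aq]] := hop_dist Z1.
move: Z2; rewrite cnb_sym -qZ => /hop_dist[q' [qZ' aq']]; exists q'; split => //.
by apply: (dist_le HD' (dist_trans HD' aq aq')); lra.
Qed.

Lemma merged_clustering : clustering D' u (cen \o G \o p) merged_bound.
Proof.
move=> a b /= ab; rewrite /merged_bound; case: ifP => [XS|/negbT XS].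
  have [q [qX aq]] := centre_dist XS; rewrite ab in XS.
  have [q' [qX' bq]] := centre_dist XS.
  have qq : D' q q' (4 * r - u) by apply/DD'/wideG; rewrite /= qX qX'.
  apply: (dist_le HD' (dist_trans HD' (dist_trans HD' aq qq) (dist_sym HD' bq))).
  by move: sr; lra.
have e1 := cen_id XS; have e2 : cen (G (p b)) = G (p b) by apply: cen_id; rewrite -ab.
have e : (G \o p) a = (G \o p) b by rewrite /= -e1 ab e2.
rewrite e1; apply: DD'; rewrite /Num.min; case: ifP => _.
  exact: (clG e).
exact: wideG.
Qed.

Lemma merged_bound_ge a : r <= merged_bound (cen (G (p a))).
Proof.
rewrite /merged_bound; case: ifP => [_|/negbT XS]; first by move: r0; lra.
rewrite (cen_id XS) le_min massG /=; by move: r0; lra.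
Qed.

Lemma merged_bound_le X : merged_bound X <= 36 * r.
Proof.
rewrite /merged_bound; case: ifP => [_|_]; first by [].
rewrite ge_min; apply/orP; right; by move: r0; lra.
Qed.

Lemma mass_centre X : X \in S -> 72 * r <= mass p f (cen \o G) X.
Proof.
move=> XS; rewrite -mass_comp /mass.
have nbX : nb p G X \subset [set Y in labels (G \o p) | cen Y == X].
  apply/fintype.subsetP => Y YX; rewrite inE (cenS XS) ?eqxx ?andbT.
    move: YX; rewrite inE => /linkP[j jJ []] [_ /= ->]; exact: (mem_labels (G \o p)).
  by rewrite inE YX orbT.
have h : \sum_(Y in nb p G X) r <=
    \sum_(Y in labels (G \o p) | cen Y == X) \sum_(l in labels p | G l == Y) f l.
  apply: (@le_trans _ _ (\sum_(Y in nb p G X) mass p f G Y)).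
    apply: ler_sum => Y /(fintype.subsetP nbX); rewrite inE => /andP[/labelsP[a ->] _].
    exact: massG.
  rewrite [X in _ <= X](bigID (fun Y => Y \in nb p G X)) /=.
  rewrite -[X in X <= _]addr0; apply: lerD.
    rewrite le_eqVlt; apply/orP; left; apply/eqP; apply: eq_bigl => Y.
    case YX : (Y \in nb p G X); rewrite ?andbF // andbT.
    by have := fintype.subsetP nbX _ YX; rewrite inE => ->.
  by apply: sumr_ge0 => Y _; apply: sumr_ge0 => l /andP[/labelsP[a ->] _].
apply: le_trans h; rewrite sumr_const -[r *+ _]mulr_natl ler_pM2r //.
have := leq_trans (Srich XS) (card_nb wideG X).
by rewrite -(@ler_nat R).
Qed.

Let centred := \sum_(l in labels p | cen (G l) \in S) f l.

Lemma merged_loss : volume (cen \o G \o p) merged_bound <= volume p f - centred / 2.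
Proof.
rewrite -(@volume_mass R U p f (cen \o G)) lerBrDr /centred.
have -> : \sum_(l in labels p | cen (G l) \in S) f l =
    \sum_(X in labels (cen \o G \o p)) if X \in S then mass p f (cen \o G) X else 0.
  rewrite (partition_big (cen \o G) (fun X => X \in labels (cen \o G \o p))) /=; last first.
    by move=> l /andP[/labelsP[a ->] _]; exact: (mem_labels (cen \o G \o p)).
  apply: eq_bigr => X _; case: ifP => XS.
    apply: eq_bigl => l; rewrite -andbA; congr andb => /=.
    by have [->|] := eqVneq (cen (G l)) X; rewrite ?XS ?andbF.
  rewrite big_pred0 // => l /=; have [->|] := eqVneq (cen (G l)) X; last by rewrite andbF.
  by rewrite XS andbF.
rewrite /volume mulr_suml -big_split /=; apply: ler_sum => X /labelsP[a ->] /=.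
rewrite /merged_bound; case: ifP => [XS|/negbT XS].
  by have := mass_centre XS; lra.
rewrite mul0r addr0 ge_min; apply/orP; left.
rewrite /mass [X in _ <= X](bigID (fun l => G l == cen (G (p a)))) /=.
rewrite -[X in X <= _]addr0; apply: lerD; last first.
  by apply: sumr_ge0 => l /andP[/andP[/labelsP[z ->]]].
rewrite le_eqVlt; apply/orP; left; apply/eqP; apply: eq_bigl => l.
rewrite -andbA; congr andb; have [->|] := eqVneq (G l) (cen (G (p a))); last by rewrite andbF.
by rewrite (cen_id XS) (cen_id XS) eqxx.
Qed.

Lemma card_active : s * #|active p|%:R <= 72 * (s / r) * volume p f + 64 * centred.
Proof.
rewrite -(cardsID [set l | rich p G (G l)] (active p)) natrD mulrDr addrC; apply: lerD.
  have h1 : (#|active p :\: [set l | rich p G (G l)]| <= 72 * #|labels (G \o p)|)%N.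
    rewrite -sum1_card (partition_big G (fun Y => Y \in labels (G \o p))) /=; last first.
      move=> l; rewrite !inE => /andP[_ /andP[/labelsP[a ->] _]]; exact: (mem_labels (G \o p)).
    rewrite mulnC -sum_nat_const; apply: leq_sum => Y _.
    rewrite sum1dep_card; have [/eqP|] := posnP #|[set l | (l \in active p :\: [set l | rich p G (G l)]) && (G l == Y)]|.
      by move=> /eqP->.
    case/card_gt0P => l0; rewrite !inE => /andP[/andP[+ _] /eqP lY].
    rewrite lY /rich -ltnNge => /ltnW; apply: leq_trans; apply: subset_leq_card.
    by apply/fintype.subsetP => l; rewrite !inE => /andP[/andP[_ ->] ->].
  have h2 : r * #|labels (G \o p)|%:R <= volume p f.
    rewrite -(@volume_mass R U p f G) /volume -sumr_const mulr_sumr.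
    by apply: ler_sum => Y /labelsP[a ->]; rewrite mulr1; apply: massG.
  have h3 : #|active p :\: [set l | rich p G (G l)]|%:R <= 72 * #|labels (G \o p)|%:R :> R.
    by rewrite -natrM ler_nat.
  have h4 : #|labels (G \o p)|%:R <= volume p f / r by rewrite ler_pdivlMr // mulrC.
  have -> : 72 * (s / r) * volume p f = s * (72 * (volume p f / r)).
    by field; rewrite gt_eqF.
  rewrite ler_pM2l //; lra.
have -> : s * #|active p :&: [set l | rich p G (G l)]|%:R =
    \sum_(l in active p :&: [set l | rich p G (G l)]) s.
  by rewrite sumr_const mulr_natr.
rewrite mulr_sumr [X in _ <= X](bigID (fun l => l \in active p :&: [set l | rich p G (G l)])) /=.
rewrite -[X in X <= _]addr0; apply: lerD; last first.
  apply: sumr_ge0 => l /andP[/andP[/labelsP[z ->] _] _]; by rewrite mulr_ge0.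
rewrite [X in _ <= X](eq_bigl (fun l => l \in active p :&: [set l | rich p G (G l)])).
  by apply: ler_sum => l; rewrite !inE => /andP[/andP[/labelsP[a ->] _] _].
move=> l; apply/andP/idP => [[]//|lA]; split => //.
by move: lA; rewrite !inE => /andP[/andP[-> _] /richS].
Qed.

Lemma assembled_step : exists p' f', [/\ clustering D' u p' f',
  forall a, 0 <= f' (p' a) <= 36 * r,
  (forall a b, p' a = p' b) \/ (forall a, r <= f' (p' a)),
  volume p' f' <= volume p f &
  s * #|J|%:R <= 144 * (s / r) * volume p f + 256 * (volume p f - volume p' f')].
Proof.
exists (cen \o G \o p), merged_bound; split.
- exact: merged_clustering.
- move=> a; rewrite merged_bound_le andbT; apply: le_trans (merged_bound_ge a).
  exact: ltW.
- by right; apply: merged_bound_ge.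
- apply: le_trans merged_loss _; rewrite gerBl divr_ge0 //.
  by apply: sumr_ge0 => l /andP[/labelsP[a ->] _].
have h1 := card_active; have h2 := merged_loss.
have : #|J|%:R <= 2 * #|active p|%:R :> R.
  rewrite -natrM ler_nat; apply: (card_chords clf) => a; by case/andP: (f0 a).
move=> h3; have h4 : s * #|J|%:R <= s * (2 * #|active p|%:R) by rewrite ler_pM2l.
lra.
Qed.

End Assembly.

Lemma level_step (p : U -> U) (f : U -> R) :
  (forall a, 0 <= f (p a) <= s) -> clustering D u p f ->
  (forall a b, p a = p b) \/ (forall a, s <= 64 * f (p a)) ->
  exists p' f', [/\ clustering D' u p' f',
  forall a, 0 <= f' (p' a) <= 36 * r,
  (forall a b, p' a = p' b) \/ (forall a, r <= f' (p' a)),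
  volume p' f' <= volume p f &
  s * #|J|%:R <= 144 * (s / r) * volume p f + 256 * (volume p f - volume p' f')].
Proof.
move=> f0 cl cst.
have fp a : 0 <= f (p a) by case/andP: (f0 a).
have r0 : 0 < r by apply: lt_le_trans sr.
have tot0 : 0 <= volume p f by apply: sumr_ge0 => l /labelsP[a ->].
have tot1 : 0 <= 144 * (s / r) * volume p f.
  by rewrite !mulr_ge0 // ?invr_ge0 ltW.
case: cst => [cst|fs].
  exists p, f; split; [by move=> a b /cl/DD'| |by left|by []|].
    by move=> a; have /andP[-> h] := f0 a; move: sr r0; lra.
  rewrite (no_chords cst _ cl) ?subrr ?mulr0 ?addr0 // => a.
  by have /andP[_ h] := f0 a; move: sr r0; lra.
have f2 a : 0 <= f (p a) < 2 * r.
  by have /andP[-> h] := f0 a; move: sr r0; lra.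
have [g [clg gr gbig]] := merge_small HD touchD f2 cl.
have mg0 X : 0 <= mass p f g X by apply: mass_ge0.
have [[a [b ab]]|cst] := pselect (exists a b, g (p a) <> g (p b)); last first.
  have {}cst a b : (g \o p) a = (g \o p) b.
    by apply: contrapT => ab; apply: cst; exists a, b.
  exists (g \o p), (mass p f g); split; [by move=> a b /clg/DD'| |by left|by rewrite volume_mass|].
    by move=> a; have := gr a; rewrite mg0 /= ; move: r0; lra.
  rewrite (no_chords cst _ clg) ?volume_mass ?subrr ?mulr0 ?addr0 // => a.
  exact: ltW (gr a).
have g2 c : 0 <= mass p f g ((g \o p) c) < 2 * r by rewrite mg0 gr.
have [c [c1 c2]] := attach_small HD touchD touch_conn (ltW r0) g2 clg gbig
  (ex_intro _ a (ex_intro _ b ab)).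
have mE X : mass (g \o p) (mass p f g) c X = mass p f (c \o g) X by apply: mass_comp.
have wd z w : ((c \o g) \o p) z = ((c \o g) \o p) w -> D z w (4 * r - u).
  by move=> e; have [] := c2 _ _ e.
have [S [cen [S1 S2 S3 S4 S5]]] := centres p (c \o g).
apply: (@assembled_step p (c \o g) f S cen) => //.
- by move=> z; rewrite -mE; apply: c1.
- by move=> z w e; rewrite -mE; have [] := c2 _ _ e.
Qed.

End LevelStep.

(** * The weight of the greedy chords *)

Section Levels.
Variables (R : realType) (U : finType) (M : nat) (x y : 'I_M -> U) (w : 'I_M -> R).
Variables (near : 'I_M -> U -> U -> R -> Prop) (touch : rel U).
Variables (J : {set 'I_M}) (u t Q : R) (n : nat).
Hypothesis Hnear : forall j, dist_rel (near j).
Hypothesis w_mono : forall i j : 'I_M, (i <= j)%N -> w i <= w j.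
Hypothesis near_earlier : forall i j : 'I_M, (i < j)%N -> near j (x i) (y i) (w i + 2 * u).
Hypothesis stretched : forall j, j \in J -> ~ near j (x j) (y j) (t * w j).
Hypothesis near_touch : forall j a b, touch a b -> near j a b u.
Hypothesis touch_conn : forall A : {set U}, A != finset.set0 -> A != [set: U] ->
  exists a b, [/\ a \in A, b \notin A & touch a b].
Hypothesis u0 : 0 < u.
Hypothesis Q1 : 1 <= Q.
Hypothesis Un : (#|U| <= 2 ^ n)%N.
Hypothesis tn : 10 * n%:R + 16 <= t.
Hypothesis tQ : 8 * Q + 4 <= t.

Definition scale k := u * (64 * Q) ^+ k.
Definition scale_set k : {set 'I_M} := [set j in J | scale k <= w j < 2 * scale k].
Definition near_from k a b r := forall j, scale k <= w j -> near j a b r.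

Lemma scale_ge k : u <= scale k.
Proof. by rewrite /scale ler_peMr ?exprn_ege1 //; [exact: ltW|move: Q1; lra]. Qed.

Lemma scaleS k : scale k.+1 = 64 * (Q * scale k).
Proof. by rewrite /scale exprS; ring. Qed.

Lemma near_from_dist k : dist_rel (near_from k).
Proof.
split=> [a|a b r h|a b c r q h h'|a b r q h rq] j jk.
- exact: dist_refl.
- by apply: dist_sym => //; apply: h.
- by apply: (dist_trans (Hnear j)); [exact: h|exact: h'].
- by apply: (dist_le (Hnear j) _ rq); apply: h.
Qed.

Lemma levels_induction k : exists p f, [/\ clustering (near_from k) u p f,
  forall a, 0 <= f (p a) <= scale k,
  (forall a b, p a = p b) \/ (forall a, scale k <= 64 * f (p a)),
  volume p f <= #|U|%:R * u &
  \sum_(i < k) scale i * #|scale_set i|%:R <=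
    144 * k%:R / Q * (#|U|%:R * u) + 256 * (#|U|%:R * u - volume p f)].
Proof.
have Q0 : 0 < Q by move: Q1; lra.
have V0 : 0 <= #|U|%:R * u by rewrite mulr_ge0 // ltW.
elim: k => [|k [p [f [cl f0 cst vol IH]]]].
  have vE : @volume R U id (fun=> u) = #|U|%:R * u.
    rewrite /volume (eq_bigr (fun=> u)) // sumr_const mulr_natl -cardsT; congr (_ *+ #|pred_of_set _|).
    by apply/setP => a; rewrite [RHS]inE; exact: (mem_labels id).
  exists id, (fun=> u); split.
  - by move=> a b /= ->; rewrite subrr; exact: dist_refl (near_from_dist 0) _.
  - by move=> a; rewrite /scale expr0 mulr1 lexx ltW.
  - by right => a; rewrite /scale expr0 mulr1; move: u0; lra.
  - by rewrite vE.
  - by rewrite big_ord0 vE subrr !mulr0 mul0r mul0r addr0.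
have s0 : 0 < scale k by apply: lt_le_trans u0 (scale_ge k).
have r0 : scale k <= Q * scale k by rewrite ler_peMl // ltW.
have kk : scale k <= scale k.+1 by rewrite scaleS; move: r0 s0; lra.
have sub2 : 2 * scale k <= scale k.+1 by rewrite scaleS; move: r0 s0; lra.
have h1 j a b q : j \in scale_set k -> near_from k a b q -> near j a b q.
  by rewrite inE => /andP[_ /andP[jk _]]; apply.
have h2 i j : i \in scale_set k -> j \in scale_set k -> (i < j)%N ->
    near j (x i) (y i) (4 * scale k).
  rewrite inE => /andP[_ /andP[_ ik]] _ ij.
  by apply: (dist_le (Hnear j) (near_earlier ij)); have := scale_ge k; move: ik; lra.
have h3 j : j \in scale_set k -> ~ near j (x j) (y j) (t * scale k).
  rewrite inE => /andP[jJ /andP[jk _]] h; apply: (stretched jJ).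
  by apply: (dist_le (Hnear j) h); rewrite ler_wpM2l //; move: tQ Q0; lra.
have h4 : 8 * (Q * scale k) + 4 * scale k <= t * scale k.
  by rewrite mulrA -mulrDl ler_pM2r.
have h5 a b q : near_from k a b q -> near_from k.+1 a b q.
  by move=> h j jk; apply: h; apply: le_trans jk.
have h6 j : j \in scale_set k -> near_from k.+1 (x j) (y j) (4 * scale k).
  rewrite inE => /andP[_ /andP[_ jk]] i ik.
  have ji : (j < i)%N.
    by rewrite ltnNge; apply/negP => /w_mono; move: ik jk sub2; lra.
  by apply: (dist_le (Hnear i) (near_earlier ji)); have := scale_ge k; move: jk; lra.
have h7 a b : touch a b -> near_from k a b u by move=> ab j _; apply: near_touch.
have [p' [f' [cl' f0' cst' vol' step]]] := level_step (near_from_dist k) (fun j _ => Hnear j)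
  h1 h2 h3 (ltW u0) s0 r0 Un tn h4 (near_from_dist k.+1) h5 h6 h7 touch_conn f0 cl cst.
exists p', f'; split => //.
- by move=> a; have /andP[-> h] := f0' a; rewrite scaleS; move: r0 s0 h; lra.
- by case: cst' => [?|h]; [left|right=> a; rewrite scaleS; have := h a; lra].
- exact: le_trans vol' vol.
rewrite big_ord_recr /=; apply: le_trans (lerD IH step) _.
have -> : scale k / (Q * scale k) = Q^-1 by field; rewrite !gt_eqF.
rewrite -natr1.
have h : 144 / Q * volume p f <= 144 / Q * (#|U|%:R * u).
  by rewrite ler_wpM2l // divr_ge0 // ltW.
lra.
Qed.

Lemma scale_sets_weight k : k%:R <= Q ->
  \sum_(i < k) scale i * #|scale_set i|%:R <= 400 * (#|U|%:R * u).
Proof.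
move=> kQ; have Q0 : 0 < Q by move: Q1; lra.
have V0 : 0 <= #|U|%:R * u by rewrite mulr_ge0 // ltW.
have [p [f [_ f0 _ vol h]]] := levels_induction k; apply: le_trans h _.
have v0 : 0 <= volume p f by apply: sumr_ge0 => l /labelsP[a ->]; case/andP: (f0 a).
have : 144 * k%:R / Q * (#|U|%:R * u) <= 144 * (#|U|%:R * u).
  apply: ler_wpM2r => //; rewrite -mulrA -[X in _ <= X]mulr1 ler_wpM2l //.
  by rewrite ler_pdivrMr // mul1r.
lra.
Qed.

End Levels.

Section Cells.
Variables (R : realType) (V : finType) (p : V -> R) (rho : V -> V -> R -> Prop).
Variables (U : Type) (pos : U -> R).
Hypothesis Hrho : dist_rel rho.
Hypothesis rho_line : forall a b, rho a b `|p a - p b|.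

(* The line and the graph glued along the vertices. *)
Definition glued a b r := `|pos a - pos b| <= r \/
  exists v v' q, rho v v' q /\ `|pos a - p v| + q + `|p v' - pos b| <= r.

Lemma glued_dist : dist_rel glued.
Proof.
split.
- by move=> a; left; rewrite subrr normr0.
- move=> a b r [h|[v [v' [q [h1 h2]]]]]; first by left; rewrite distrC.
  right; exists v', v, q; split; first exact: dist_sym.
  rewrite [`|pos b - _|]distrC [`|p v - _|]distrC; lra.
- move=> a b c r q [h|[v [v' [d [h1 h2]]]]] [h'|[z [z' [e [h1' h2']]]]].
  + by left; have := ler_distD (pos b) (pos a) (pos c); lra.
  + right; exists z, z', e; split => //.
    by have := ler_distD (pos b) (pos a) (p z); lra.
  + right; exists v, v', d; split => //.
    by have := ler_distD (pos b) (p v') (pos c); lra.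
  + right; exists v, z', (d + `|p v' - p z| + e); split.
      by apply: dist_trans h1' => //; apply: dist_trans h1 _ => //.
    by have := ler_distD (pos b) (p v') (p z); lra.
- move=> a b r q [h|[v [v' [d [h1 h2]]]]] rq; first by left; lra.
  by right; exists v, v', d; split => //; lra.
Qed.

Variables (cell : V -> U) (u : R).
Hypothesis cellP : forall v, `|p v - pos (cell v)| <= u.

Lemma glued_cell v v' r : rho v v' r -> glued (cell v) (cell v') (r + 2 * u).
Proof.
move=> h; right; exists v, v', r; split => //.
by have := cellP v; have := cellP v'; rewrite [`|p v - _|]distrC; lra.
Qed.

Lemma cell_glued v v' r : glued (cell v) (cell v') r -> rho v v' (r + 2 * u).
Proof.
have h1 := cellP v; have h2 := cellP v'; move=> [h|[z [z' [q [h3 h4]]]]].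
  apply: (dist_le Hrho (rho_line v v')).
  have := ler_distD (pos (cell v)) (p v) (p v').
  have := ler_distD (pos (cell v')) (pos (cell v)) (p v').
  by rewrite distrC in h2; lra.
have := dist_trans Hrho (dist_trans Hrho (rho_line v z) h3) (rho_line z' v').
move/(dist_le Hrho); apply.
have := ler_distD (pos (cell v)) (p v) (p z).
have := ler_distD (pos (cell v')) (p z') (p v').
by rewrite distrC in h2; lra.
Qed.

End Cells.

Section ChordWeight.
Variables (R : realType) (V : finType) (M : nat) (x y : 'I_M -> V) (w : 'I_M -> R).
Variables (rho : 'I_M -> V -> V -> R -> Prop) (p : V -> R) (L : R) (b : nat) (K : {set V}).
Hypothesis Hrho : forall j, dist_rel (rho j).
Hypothesis rho_line : forall j v v', rho j v v' `|p v - p v'|.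
Hypothesis w_mono : forall i j : 'I_M, (i <= j)%N -> w i <= w j.
Hypothesis w0 : forall j, 0 <= w j.
Hypothesis rho_earlier : forall i j : 'I_M, (i < j)%N -> rho j (x i) (y i) (w i).
Hypothesis stretched : forall j, ~ rho j (x j) (y j) (40 * b%:R * w j).
Hypothesis pL : forall v, 0 <= p v <= L.
Hypothesis L0 : 0 < L.
Hypothesis b0 : (0 < b)%N.
Hypothesis xyK : forall j, x j \in K /\ y j \in K.
Hypothesis cardK : (#|K| <= 2 ^ b)%N.

Let b1 : 1 <= b%:R :> R. Proof. by rewrite ler1n. Qed.

Lemma class_weight m (Q : R) k : (0 < m <= 2 ^ b)%N -> 1 <= Q <= 2 * b%:R -> k%:R <= Q ->
  \sum_(i < k) scale (L / m%:R) Q i *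
     #|[set j | scale (L / m%:R) Q i <= w j < 2 * scale (L / m%:R) Q i]|%:R <= 800 * L.
Proof.
move=> /andP[m0 mb] /andP[Q1 Qb] kQ; set u := L / m%:R.
have mR : 0 < m%:R :> R by rewrite ltr0n.
have u0 : 0 < u by rewrite divr_gt0.
have uL : u * m%:R = L by rewrite /u divfK // gt_eqF.
pose pos (a : 'I_m.+1) : R := (a : nat)%:R * u.
pose touch : rel 'I_m.+1 := fun a c => ((a : nat).+1 == c) || ((c : nat).+1 == a).
pose cell v : 'I_m.+1 := inord (Num.truncn (p v / u)).
have cellP v : `|p v - pos (cell v)| <= u.
  have /andP[p0 pl] := pL v.
  have pu : 0 <= p v / u by rewrite divr_ge0 // ltW.
  have /andP[h1 h2] := truncn_itv pu.
  have tm : (Num.truncn (p v / u) < m.+1)%N.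
    rewrite ltnS -(ler_nat R); apply: le_trans h1 _.
    by rewrite ler_pdivrMr // mulrC uL.
  rewrite /pos /cell inordK //; move: h1 h2; rewrite ler_pdivlMr // ltr_pdivrMr //.
  by rewrite -natr1 => h1 h2; rewrite ger0_norm; lra.
pose near j := glued p (rho j) pos.
have Hnear j : dist_rel (near j) by apply: glued_dist.
have near_earlier (i j : 'I_M) : (i < j)%N -> near j (cell (x i)) (cell (y i)) (w i + 2 * u).
  by move=> /rho_earlier h; apply: glued_cell.
pose J := [set j | u <= w j].
have near_stretched j : j \in J -> ~ near j (cell (x j)) (cell (y j)) ((40 * b%:R - 2) * w j).
  rewrite inE => uj h; apply: (stretched (j := j)).
  apply: (dist_le (Hrho j) (cell_glued (Hrho j) (rho_line j) cellP h)); lra.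
have near_touch j a c : touch a c -> near j a c u.
  have h (d e : 'I_m.+1) : (d : nat).+1 = e -> `|pos d - pos e| <= u.
    by move=> de; rewrite /pos -de -natr1 mulrDl opprD addrA subrr sub0r mul1r normrN ger0_norm // ltW.
  by move=> /orP[/eqP/h|/eqP/h]; [left|rewrite distrC; left].
have conn (A : {set 'I_m.+1}) : A != finset.set0 -> A != [set: 'I_m.+1] ->
    exists a c, [/\ a \in A, c \notin A & touch a c].
  move=> /set0Pn[a aA] AT; apply: contrapT => no; case/negP: AT.
  have step c d : c \in A -> touch c d -> d \in A.
    by move=> cA cd; apply: contraT => dA; case: no; exists c, d.
  have zeroA n : forall c : 'I_m.+1, (c : nat) = n -> c \in A -> ord0 \in A.
    elim: n => [|n IH] c cn cA; first by rewrite -(_ : c = ord0) //; apply/val_inj.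
    have nm : (n < m.+1)%N by apply: leq_trans (ltn_ord c); rewrite cn.
    apply: (IH (Ordinal nm)) => //; apply: step cA _.
    by rewrite /touch /= cn eqxx orbT.
  have allA n : forall c : 'I_m.+1, (c : nat) = n -> c \in A.
    elim: n => [|n IH] c cn.
      by rewrite (_ : c = ord0); [exact: zeroA erefl aA|apply/val_inj].
    have nm : (n < m.+1)%N by apply: leq_trans (ltn_ord c); rewrite cn.
    by apply: (step (Ordinal nm)); [exact: IH|rewrite /touch /= cn eqxx].
  by apply/eqP/setP => c; rewrite inE; apply: allA.
have cardU : (#|'I_m.+1| <= 2 ^ b.+1)%N.
  by rewrite card_ord expnS; move: mb (expn_gt0 2 b); clear; lia.
have tn : 10 * b.+1%:R + 16 <= 40 * b%:R - 2 :> R by rewrite -[b.+1%:R]natr1; move: b1; lra.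
have tQ : 8 * Q + 4 <= 40 * b%:R - 2 by move: b1; lra.
have := scale_sets_weight Hnear w_mono near_earlier near_stretched near_touch conn u0 Q1 cardU tn tQ kQ.
rewrite card_ord => h; apply: (@le_trans _ _ (400 * (m.+1%:R * u))).
  apply: le_trans h; apply: ler_sum => i _; rewrite ler_wpM2l //.
    exact: le_trans (ltW u0) (scale_ge u0 Q1 i).
  rewrite ler_nat; apply: subset_leq_card; apply/fintype.subsetP => j; rewrite !inE => jk.
  by rewrite jk andbT; case/andP: jk => jk _; apply: le_trans (scale_ge u0 Q1 i) jk.
rewrite -[m.+1%:R]natr1 [(_ + 1) * u]mulrDl mul1r [m%:R * u]mulrC uL.
have : u <= L by rewrite -uL ler_peMr ?ler1n // ltW.
lra.
Qed.

Lemma card_chords_below (c : R) : (#|[set j | (w j <= c)%R]| <= 2 * 2 ^ b)%N.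
Proof.
apply: (@leq_trans (2 * #|K|)); last by rewrite leq_mul2l.
apply: (@moore_bound V M x y _ K b) => [|j _|//]; last exact: xyK.
apply: ordered_no_short_cycle => j _ [q [qp ql qs]]; apply: (stretched (j := j)).
have H a : path (link x y [set i in [set j | w j <= c] | (i < j)%N]) a q ->
    rho j a (last a q) ((size q)%:R * w j).
  elim: q a {qp ql qs} => [|d q IH] a /=; first by rewrite mul0r => _; apply: dist_refl.
  move=> /andP[/linkP[i + ad] /IH h]; rewrite inE => /andP[_ ij].
  rewrite -natr1 mulrDl mul1r addrC; apply: (dist_trans (Hrho j)) h.
  apply: (dist_le (Hrho j) _ (w_mono (ltnW ij))).
  by case: ad => -[-> ->]; [|apply: (dist_sym (Hrho j))]; apply: rho_earlier.
apply: (dist_le (Hrho j) _ (_ : (size q)%:R * w j <= _)).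
  by rewrite -ql; apply: H.
apply: ler_wpM2r => //; have : (size q)%:R <= 2 * b%:R + 3 :> R.
  by rewrite -natrM -natrD ler_nat.
by move: b1; lra.
Qed.

Lemma sum_blocks (F : nat -> R) q n :
  \sum_(e < q * n) F e = \sum_(k < n) \sum_(r < q) F (q * k + r)%N.
Proof.
elim: n => [|n IH]; first by rewrite muln0 !big_ord0.
by rewrite big_ord_recr /= -IH mulnS addnC big_split_ord.
Qed.

Lemma w_small j : w j < L.
Proof.
rewrite ltNge; apply/negP => Lw; apply: (stretched (j := j)).
apply: (dist_le (Hrho j) (rho_line j (x j) (y j))).
apply: (@le_trans _ _ L).
  by have := pL (x j); have := pL (y j); case: ler0P; lra.
apply: le_trans Lw _; rewrite ler_peMl ?w0 //; move: b1; lra.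
Qed.

Lemma chords_weight : \sum_j w j <= (2 + 1600 * (up_log 2 b + 6)%:R) * L.
Proof.
set kap := (up_log 2 b + 6)%N; pose c := L / 2 ^+ b.
have p2 n : 0 < 2 ^+ n :> R by rewrite exprn_gt0.
have c0 : 0 < c by rewrite divr_gt0.
have cb : c * 2 ^+ b = L by rewrite /c divfK // gt_eqF.
pose sig e := c * 2 ^+ e.
have sig0 e : 0 < sig e by rewrite mulr_gt0.
pose Je e := [set j | sig e <= w j < 2 * sig e].
pose F e := sig e * #|Je e|%:R.
have F0 e : 0 <= F e by rewrite mulr_ge0 // ltW.
rewrite (bigID (fun j => j \in [set j | w j <= c])) /= mulrDl; apply: lerD.
  apply: (@le_trans _ _ (\sum_(j in [set j | w j <= c]) c)).
    by apply: ler_sum => j; rewrite inE.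
  rewrite sumr_const -[c *+ _]mulr_natl -cb mulrA [2 * c]mulrC -mulrA [X in _ <= X]mulrC.
  rewrite ler_pM2r // -natrX -natrM ler_nat; exact: card_chords_below.
apply: (@le_trans _ _ (\sum_(e < b) 2 * F e)).
  apply: (@le_trans _ _ (\sum_(e < b) \sum_(j in Je e) w j)); last first.
    apply: ler_sum => e _; rewrite /F mulrA -sumr_const mulr_sumr.
    by apply: ler_sum => j; rewrite inE mulr1 => /andP[_ /ltW].
  rewrite (exchange_big_dep xpredT) //= big_mkcond /=; apply: ler_sum => j _.
  case: ifP => [|_]; last by apply: sumr_ge0.
  rewrite inE -ltNge => cj.
  have ex : exists e, w j < sig e.+1.
    exists b.-1; rewrite prednK // /sig cb; exact: w_small.
  case: (ex_minnP ex) => e we emin.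
  have eb : (e < b)%N.
    by rewrite -(prednK b0) ltnS; apply: emin; rewrite prednK // /sig cb; exact: w_small.
  have je : j \in Je e.
    rewrite inE; apply/andP; split; last by move: we; rewrite /sig exprS mulrCA.
    case: (e) emin => [|e'] emin; first by rewrite /sig expr0 mulr1 ltW.
    by rewrite leNgt; apply/negP => /emin; rewrite ltnn.
  rewrite (bigD1 (Ordinal eb)) //= lerDl; exact: sumr_ge0.
rewrite -mulr_sumr.
apply: (@le_trans _ _ (2 * \sum_(e < kap * b) F e)).
  rewrite ler_pM2l // -!(big_mkord xpredT F).
  rewrite [X in _ <= X](@big_cat_nat _ _ _ b) //=; last by rewrite leq_pmull // /kap addnS.
  by rewrite lerDl; apply: sumr_ge0.
rewrite sum_blocks exchange_big /=.
have -> : 1600 * kap%:R * L = 2 * \sum_(r < kap) 800 * L.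
  by rewrite sumr_const card_ord -mulr_natl; ring.
rewrite ler_pM2l //; apply: ler_sum => r _.
have [rb|br] := ltnP r b; last first.
  rewrite big1 => [|k _].
    by apply: mulr_ge0; [exact: ler0n|exact: ltW].
  rewrite /F; have -> : Je (kap * k + r)%N = finset.set0; last by rewrite cards0 mulr0.
  apply/setP => j; rewrite !inE; apply/negbTE/negP => /andP[h _].
  have := w_small j; rewrite ltNge => /negP; apply; apply: le_trans h.
  rewrite -cb /sig ler_pM2l // ler_eXn2l // ?ltr1n //.
  exact: leq_trans br (leq_addl _ _).
pose Q : R := (2 ^ up_log 2 b)%:R.
have kE k : scale (L / (2 ^ (b - r))%:R) Q k = sig (kap * k + r)%N.
  have e64 : 64 * Q = 2 ^+ kap by rewrite /kap exprD /Q natrX -[64]/((2 ^ 6)%:R) natrX mulrC.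
  have eb : 2 ^+ b = 2 ^+ (b - r) * 2 ^+ r :> R by rewrite -exprD subnK // ltnW.
  rewrite /scale /sig /c e64 -exprM exprD natrX eb.
  by field; rewrite ?gt_eqF.
have := @class_weight (2 ^ (b - r)) Q b _ _ _.
rewrite (eq_bigr (fun k : 'I_b => F (kap * k + r)%N)); last by move=> k _; rewrite kE.
apply.
- by rewrite expn_gt0 leq_exp2l // leq_subr.
- have [b2|] := ltnP 1 b.
    rewrite /Q ler1n expn_gt0 /= -natrM ler_nat.
    have /andP[h _] := up_log_bounds (isT : (1 < 2)%N) b2.
    have : (0 < up_log 2 b)%N by rewrite up_log_gt0.
    by move: h; case: (up_log 2 b) => // n /= h _; rewrite expnS leq_mul2l /= ltnW.
  by rewrite /Q; move: b0; case: (b) => [|[|]] // _ _; rewrite up_log1 expn0; lra.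
- by rewrite /Q ler_nat up_logP.
Qed.

End ChordWeight.

(** * Walks, the line embedding and the greedy spanner *)

Section Walks.
Variables (R : realType) (V : finType) (w : {set V} -> R).
Implicit Types (F H : {set {set V}}) (x y : V) (p : seq V).

Lemma adj_sym F : symmetric (adj F).
Proof. by move=> x y; rewrite /adj finset.setUC. Qed.

Lemma walk_weight_cons x y p : walk_weight w x (y :: p) = w [set x; y]%SET + walk_weight w y p.
Proof. by rewrite /walk_weight /= big_cons. Qed.

Lemma walk_weight_cat x p q :
  walk_weight w x (p ++ q) = walk_weight w x p + walk_weight w (last x p) q.
Proof.
elim: p x => [|y p IH] x /=; first by rewrite /walk_weight big_nil add0r.
by rewrite !walk_weight_cons IH addrA.
Qed.

Lemma walk_weight_rev x p : walk_weight w (last x p) (rev (belast x p)) = walk_weight w x p.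
Proof.
elim: p x => [|y p IH] x /=; first by rewrite /walk_weight !big_nil.
rewrite rev_cons -cats1 walk_weight_cat IH [RHS]walk_weight_cons [RHS]addrC; congr (_ + _).
rewrite walk_weight_cons /walk_weight big_nil addr0 finset.setUC.
by case: p {IH} => [|z p] //=; rewrite rev_cons last_rcons.
Qed.

Lemma walk_weight_ge0 F x p : nonneg_weights F w -> path (adj F) x p -> 0 <= walk_weight w x p.
Proof.
move=> wF; elim: p x => [|y p IH] x /=; first by rewrite /walk_weight big_nil.
by move=> /andP[xy /IH h]; rewrite walk_weight_cons addr_ge0 ?wF.
Qed.

Definition within F x y r := exists p,
  [/\ path (adj F) x p, last x p = y & walk_weight w x p <= r].

Lemma within_dist F : dist_rel (within F).
Proof.
split.
- by move=> x; exists [::]; split => //; rewrite /walk_weight big_nil.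
- move=> x y r [p [pF pl pr]]; exists (rev (belast x p)); split.
  + by rewrite -pl rev_path; apply: sub_path pF => a b; rewrite adj_sym.
  + by case: p pl {pF pr} => [|z p] //= _; rewrite rev_cons last_rcons.
  + by rewrite -pl walk_weight_rev.
- move=> x y z r q [p [pF pl pr]] [p' [pF' pl' pr']]; exists (p ++ p'); split.
  + by rewrite cat_path pF pl.
  + by rewrite last_cat pl.
  + by rewrite walk_weight_cat pl lerD.
- by move=> x y r q [p [pF pl pr]] rq; exists p; split => //; apply: le_trans rq.
Qed.

Lemma within_sub F H x y r : F \subset H -> within F x y r -> within H x y r.
Proof.
move=> /fintype.subsetP FH [p [pF pl pr]]; exists p; split => //.
by apply: sub_path pF => a b; apply: FH.
Qed.

Lemma within_adj F x y : adj F x y -> within F x y (w [set x; y]%SET).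
Proof.
move=> xy; exists [:: y]; split => //=; first by rewrite xy.
by rewrite walk_weight_cons /walk_weight big_nil addr0.
Qed.

Lemma within_ge0 F x y r : nonneg_weights F w -> within F x y r -> 0 <= r.
Proof. by move=> wF [p [/(walk_weight_ge0 wF) h _]]; apply: le_trans. Qed.

Lemma within_connect F x y : connect (adj F) x y -> exists r, within F x y r.
Proof.
by move=> /connectP[p pF pl]; exists (walk_weight w x p), p; split.
Qed.

Lemma simple_walk F x p : nonneg_weights F w -> path (adj F) x p ->
  exists q, [/\ path (adj F) x q, last x q = last x p, uniq (x :: q) &
    walk_weight w x q <= walk_weight w x p].
Proof.
move=> wF; elim: p x => [|y p IH] x; first by exists [::].
rewrite /= => /andP[xy /IH[q [qF ql qu qw]]].
have [xq|xq] := boolP (x \in y :: q); last first.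
  exists (y :: q); rewrite /= xy qF ql; split => //; first by apply/andP; split.
  by rewrite !walk_weight_cons lerD2l.
have wxy : 0 <= w [set x; y]%SET by apply: wF.
rewrite walk_weight_cons; move: xq; rewrite inE => /orP[/eqP e|xq].
  by subst y; exists q; split => //; lra.
case/splitPr: xq qF ql qu qw => q1 q2; rewrite cat_path last_cat /= => /andP[q1F /andP[q1x q2F]] ql qu qw.
exists q2; rewrite ql; split => //.
  by move: qu; rewrite cat_uniq => /andP[_ /and3P[_ _ ]].
have := walk_weight_ge0 wF q1F; have := wF _ q1x.
by move: qw; rewrite walk_weight_cat walk_weight_cons; lra.
Qed.

Lemma shortest F : nonneg_weights F w -> connected_graph F ->
  exists d : V -> V -> R, forall x y, within F x y (d x y) /\
    forall r, within F x y r -> d x y <= r.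
Proof.
move=> wF cF.
suff ex x y : exists r, within F x y r /\ forall q, within F x y q -> r <= q.
  by exists (fun x y => projT1 (cid (ex x y))) => x y; case: (cid _).
have bnd p : uniq (x :: p) -> (size p <= #|V|)%N.
  by move=> /andP[_ pu]; rewrite -(card_uniqP pu) max_card.
pose P (p : #|V|.-bseq V) := path (adj F) x p && (last x p == y).
have [r [p [pF pl _]]] := within_connect (cF x y).
have [q [qF ql qu qw]] := simple_walk wF pF.
have P0 : P (Bseq (bnd _ qu)) by rewrite /P /= qF ql pl eqxx.
case: (@arg_minP _ R _ (Bseq (bnd _ qu)) P (fun p : #|V|.-bseq V => walk_weight w x p) P0) => i /andP[iF /eqP il] imin.
exists (walk_weight w x i); split; first by exists i.
move=> s [p' [pF' pl' pr']]; apply: le_trans pr'.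
have [q' [qF' ql' qu' qw']] := simple_walk wF pF'; apply: le_trans qw'.
by apply: (imin (Bseq (bnd _ qu'))); rewrite /P /= qF' ql' pl' eqxx.
Qed.

Lemma total_weight_ge0 F : nonneg_weights F w -> 0 <= total_weight w F.
Proof. by move=> wF; apply: sumr_ge0. Qed.

Lemma total_weightU F H : nonneg_weights (F :|: H) w ->
  total_weight w (F :|: H) <= total_weight w F + total_weight w H.
Proof.
move=> wFH; rewrite /total_weight (bigID (fun e => e \in F)) /=; apply: lerD.
  rewrite le_eqVlt; apply/orP; left; apply/eqP/eq_bigl => e; rewrite inE.
  by case: (e \in F); rewrite ?andbF.
rewrite [X in _ <= X](bigID (fun e => e \notin F)) /= -[X in X <= _]addr0.
apply: lerD; last by apply: sumr_ge0 => e /andP[eH _]; apply: wFH; rewrite inE eH orbT.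
rewrite le_eqVlt; apply/orP; left; apply/eqP/eq_bigl => e; rewrite inE.
by case: (e \in F); rewrite ?andbF.
Qed.

Lemma total_weight_bigcup (I : finType) (A : {set I}) (F : I -> {set {set V}}) E :
  nonneg_weights E w -> (forall i, i \in A -> F i \subset E) ->
  total_weight w (\bigcup_(i in A) F i) <= \sum_(i in A) total_weight w (F i).
Proof.
move=> wE FE.
suff [h _] : total_weight w (\bigcup_(i in A) F i) <= \sum_(i in A) total_weight w (F i) /\
    \bigcup_(i in A) F i \subset E by [].
apply: (big_rec2 (fun X s => total_weight w X <= s /\ X \subset E)).
  by rewrite /total_weight big_set0 finset.sub0set.
move=> i X s iA [h XE]; have FXE : F i :|: X \subset E by rewrite finset.subUset FE.
split => //; apply: le_trans (total_weightU _) _; last by rewrite lerD2l.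
by move=> e /(fintype.subsetP FXE); apply: wE.
Qed.

Lemma walk_subgraph F x y r : nonneg_weights F w -> within F x y r ->
  exists P : {set {set V}}, [/\ P \subset F, within P x y r & total_weight w P <= r].
Proof.
move=> wF [p [pF pl pr]].
suff [P [PF pP Pw]] : exists P : {set {set V}}, [/\ P \subset F, path (adj P) x p &
    total_weight w P <= walk_weight w x p].
  by exists P; split => //; [exists p|apply: le_trans pr].
elim: p x pF {pl pr} => [|z p IH] x /=.
  by move=> _; exists finset.set0; rewrite finset.sub0set /total_weight /walk_weight big_set0 big_nil.
move=> /andP[xz /IH[P [PF pP Pw]]]; exists ([set x; z]%SET |: P); split.
- by rewrite finset.subUset PF finset.sub1set andbT.
- rewrite /adj !inE eqxx /=; apply: sub_path pP => a b; rewrite /adj => h.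
  by rewrite inE h orbT.
- rewrite walk_weight_cons; apply: le_trans (total_weightU _) _.
    by move=> e; rewrite !inE => /orP[/eqP->|/(fintype.subsetP PF)]; [apply: wF|apply: wF].
  by rewrite /total_weight big_set1 lerD2l.
Qed.

Lemma dist_within F x y r : within F x y r -> (dist w F x y <= r%:E)%E.
Proof.
move=> [p [pF pl pr]]; apply: (@le_trans _ _ (walk_weight w x p)%:E); last by rewrite lee_fin.
by apply: ereal_inf_lbound; exists p.
Qed.

Lemma dist_shortest F x y d : within F x y d -> (forall r, within F x y r -> d <= r) ->
  dist w F x y = d%:E.
Proof.
move=> h1 h2; apply/eqP; rewrite eq_le dist_within //=.
by apply: le_ereal_inf_tmp => _ [p [pF pl ->]]; rewrite lee_fin; apply: h2; exists p.
Qed.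

(* Vertices are inserted one at a time: a new vertex is placed right after a
   neighbour, everything further right being shifted by twice the edge. *)
Lemma line_embedding T : nonneg_weights T w -> connected_graph T ->
  exists f : V -> R, (forall v, 0 <= f v <= 2 * total_weight w T) /\
    forall x y, within T x y `|f x - f y|.
Proof.
move=> wT cT; have W0 := total_weight_ge0 wT.
have [x0 _|noV] := pickP V; last by exists (fun=> 0); split=> v; have := noV v.
pose WS (S : {set V}) := \sum_(e in T | e \subset S) w e.
have [S [S1 [f [f1 f2]]]] : exists S : {set V}, S = [set: V] /\ exists f : V -> R,
    (forall v, v \in S -> 0 <= f v <= 2 * WS S) /\
    forall x y, x \in S -> y \in S -> within T x y `|f x - f y|.
  suff key n : (n <= #|V|)%N -> exists S : {set V}, [/\ (n <= #|S|)%N, x0 \in S & exists f : V -> R,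
    (forall v, v \in S -> 0 <= f v <= 2 * WS S) /\
    forall x y, x \in S -> y \in S -> within T x y `|f x - f y|].
    have [S [nS xS h]] := key _ (leqnn _); exists S; split => //.
    by apply/eqP; rewrite eqEcard finset.subsetT cardsT.
  elim: n => [_|n IH nV].
    exists [set x0]; split; rewrite ?inE //; exists (fun=> 0); split => [v _|x y].
      by rewrite lexx mulr_ge0 //; apply: sumr_ge0 => e /andP[/wT].
    by rewrite !inE => /eqP-> /eqP->; rewrite subrr normr0; apply: dist_refl (within_dist T) _.
  have [S [nS xS [f [f1 f2]]]] := IH (ltnW nV).
  have [e|ne] := eqVneq S [set: V]; first by exists S; split => //; [rewrite e cardsT|exists f].
  have [x [y [xS' yS xy]]] : exists x y, [/\ x \in S, y \notin S & adj T x y].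
    apply: contrapT => no; case/eqP: ne; apply/setP => y; rewrite inE.
    have cl : fingraph.closed (adj T) (mem S).
      move=> a b ab; apply/idP/idP => h; apply: contraT => h'; case: no; [by exists a, b|].
      by exists b, a; rewrite adj_sym.
    by rewrite -(fingraph.closed_connect cl (cT x0 y)).
  set c := w [set x; y]%SET; have c0 : 0 <= c by apply: wT.
  have WSc : WS S + c <= WS (y |: S).
    rewrite /WS [X in _ <= X](bigID (fun e : {set V} => e \subset S)) /=; apply: lerD.
      rewrite le_eqVlt; apply/orP; left; apply/eqP/eq_bigl => e; rewrite -andbA; congr andb.
      case eS: (e \subset S); rewrite ?andbF // andbT; apply/esym.
      exact: fintype.subset_trans eS (finset.subsetUr _ _).
    rewrite (bigD1 [set x; y]%SET) /=; last first.
      rewrite (_ : _ \in T) ?xy //= finset.subUset !finset.sub1set !inE xS' eqxx orbT /=.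
      by rewrite finset.subUset !finset.sub1set (negbTE yS) andbF.
    by rewrite lerDl; apply: sumr_ge0 => e /andP[/andP[/andP[/wT]]].
  exists (y |: S); split.
  - by rewrite cardsU1 yS add1n ltnS.
  - by rewrite inE xS orbT.
  pose g z := if z == y then f x + c else if f x < f z then f z + 2 * c else f z.
  have gS z : z \in S -> g z = if f x < f z then f z + 2 * c else f z.
    by rewrite /g; case: eqP => // -> ; rewrite (negbTE yS).
  have gy : g y = f x + c by rewrite /g eqxx.
  have h z : z \in S -> within T z y `|g z - g y|.
    move=> zS; have := dist_trans (within_dist T) (f2 _ _ zS xS') (within_adj xy).
    move/(dist_le (within_dist T)); apply; rewrite gS // gy -/c; case: ifP => [lt|/negbT].
      by rewrite gtr0_norm ?subr_gt0 // ger0_norm; lra.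
    by rewrite -leNgt => le; rewrite ler0_norm ?subr_le0 // ler0_norm; lra.
  exists g; split.
    move=> z; rewrite !inE => /orP[/eqP->|zS].
      by rewrite gy; have /andP[? ?] := f1 _ xS'; apply/andP; split; lra.
    rewrite gS //; have /andP[? ?] := f1 _ zS; case: ifP => _; apply/andP; split; lra.
  move=> a b; rewrite !inE => /orP[/eqP->|aS] /orP[/eqP->|bS].
  - by rewrite subrr normr0; apply: dist_refl (within_dist T) _.
  - by rewrite distrC; apply: dist_sym (within_dist T) _ _ _ (h _ bS).
  - exact: h.
  apply: (dist_le (within_dist T) (f2 _ _ aS bS)); rewrite !gS //.
  case: ifP => [lt|/negbT le]; case: ifP => [lt'|/negbT le'] //.
  - by rewrite opprD addrACA subrr addr0.
  - rewrite -leNgt in le'; rewrite ger0_norm ?ger0_norm; lra.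
  - rewrite -leNgt in le; rewrite ler0_norm ?ler0_norm; lra.
have WT : WS [set: V] = total_weight w T.
  by apply: eq_bigl => e; rewrite finset.subsetT andbT.
exists f; split => [v|x y]; last by apply: f2; rewrite S1 inE.
by rewrite -WT -S1; apply: f1; rewrite S1 inE.
Qed.

End Walks.

Section Greedy.
Variables (R : realType) (V : finType) (w : {set V} -> R) (E T : {set {set V}}).
Variables (d : V -> V -> R) (t : R).
Hypothesis wE : nonneg_weights E w.
Hypothesis TE : T \subset E.
Hypothesis dP : forall x y, within w E x y (d x y) /\
  forall r, within w E x y r -> d x y <= r.
Hypothesis t1 : 1 <= t.

Lemma distance_ge0 x y : 0 <= d x y.
Proof. by have [h _] := dP x y; apply: within_ge0 h. Qed.

Lemma distance_sym x y : d x y = d y x.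
Proof.
by apply/eqP; rewrite eq_le; apply/andP; split; apply: (dP _ _).2;
  apply: dist_sym (within_dist w E) _ _ _ (dP _ _).1.
Qed.

Lemma distance_triangle x y z : d x z <= d x y + d y z.
Proof.
by apply: (dP _ _).2; apply: dist_trans (within_dist w E) _ _ _ _ _ (dP _ _).1 (dP _ _).1.
Qed.

Definition longer (e e' : V * V) := d e.1 e.2 <= d e'.1 e'.2.

Lemma greedy_spanner e0 (ps : seq (V * V)) : sorted longer ps ->
  exists (es : seq (V * V)) (H : nat -> {set {set V}}),
  [/\ subseq es ps, H 0%N = T /\ (forall i, H i \subset H i.+1 /\ H i \subset E),
    forall i, (i < size es)%N -> let e := nth e0 es i in
      within w (H i.+1) e.1 e.2 (d e.1 e.2) /\ ~ within w (H i) e.1 e.2 (t * d e.1 e.2),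
    total_weight w (H (size es)) <= total_weight w T + \sum_(e <- es) d e.1 e.2 &
    forall e, e \in ps -> within w (H (size es)) e.1 e.2 (t * d e.1 e.2)].
Proof.
elim/last_ind: ps => [|ps e IH] srt.
  exists [::], (fun=> T); split => //.
  by rewrite big_nil addr0.
have srt' : sorted longer ps.
  by move: srt; case: (ps) => //= a l; rewrite rcons_path => /andP[].
have [es [H [sub [H0 HH] Hn Hw Hps]]] := IH srt'.
set n := size es in Hw Hps *.
have [yes|no] := pselect (within w (H n) e.1 e.2 (t * d e.1 e.2)).
  exists es, H; split => //.
    by apply: subseq_trans sub _; apply: subseq_rcons.
  by move=> e'; rewrite mem_rcons inE => /orP[/eqP->|/Hps].
have [P [PE PP Pw]] := walk_subgraph wE (dP e.1 e.2).1.
pose H' i := if (i <= n)%N then H i else H n :|: P.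
have mono i j : (i <= j)%N -> H i \subset H j.
  move=> ij; rewrite -(subnK ij); elim: (j - i)%N => [|k IHk] //.
  by apply: fintype.subset_trans IHk _; rewrite addSn; have [] := HH (k + i)%N.
have H'n : H' n = H n by rewrite /H' leqnn.
have H'S : H' n.+1 = H n :|: P by rewrite /H' ltnn.
exists (rcons es e), H'; rewrite size_rcons -/n; split.
- by rewrite -!cats1 cat_subseq.
- split; first by rewrite /H' leq0n H0.
  move=> i; rewrite /H'; case: (ltngtP i n) => [lt|gt|->].
  + by have [] := HH i.
  + by split; [exact: subxx|rewrite finset.subUset PE (HH n).2].
  + by split; [exact: finset.subsetUl|exact: (HH n).2].
- move=> i; rewrite ltnS leq_eqVlt => /orP[/eqP->|lt].
    rewrite nth_rcons -/n ltnn eqxx H'n H'S; split => //.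
    exact: within_sub (finset.subsetUr _ _) PP.
  rewrite nth_rcons lt /H' lt (ltnW lt); exact: Hn.
- rewrite H'S -cats1 big_cat big_seq1 /= addrA; apply: le_trans (total_weightU _) _.
    move=> f; rewrite inE => /orP[/(fintype.subsetP (HH n).2)|/(fintype.subsetP PE)]; exact: wE.
  exact: lerD.
- move=> f; rewrite mem_rcons inE H'S => /orP[/eqP->|/Hps h]; last first.
    exact: within_sub (finset.subsetUl _ _) h.
  apply: (dist_le (within_dist w _) (within_sub (finset.subsetUr _ _) PP)).
  by rewrite ler_peMl // distance_ge0.
Qed.

End Greedy.

Section TerminalSpanner.
Variables (R : realType) (V : finType) (w : {set V} -> R) (E T : {set {set V}}).
Hypothesis wE : nonneg_weights E w.
Hypothesis TE : T \subset E.
Hypothesis cT : connected_graph T.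

Lemma interval_packing (B : {set V}) (p r : V -> R) lo hi : lo <= hi ->
  (forall v, v \in B -> 0 <= r v /\ lo <= p v - r v /\ p v + r v <= hi) ->
  (forall v v', v \in B -> v' \in B -> v != v' -> r v + r v' <= `|p v - p v'|) ->
  \sum_(v in B) 2 * r v <= hi - lo.
Proof.
elim: {B}_.+1 {-2}B (ltnSn #|B|) hi => // n IH B Bn hi lohi Bin Bdis.
have [->|[v0 v0B]] := set_0Vmem B; first by rewrite big_set0 subr_ge0.
case: (@arg_maxP _ R _ v0 (mem B) p v0B) => v vB0 vmax.
have {vB0}vB : v \in B := vB0.
have [rv [lov hiv]] := Bin _ vB.
rewrite (big_setD1 v) //=.
have : \sum_(i in B :\ v) 2 * r i <= (p v - r v) - lo.
  apply: IH.
  - by move: Bn; rewrite (cardsD1 v) vB.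
  - exact: lov.
  - move=> z; rewrite !inE => /andP[zv zB]; have [rz [loz hiz]] := Bin _ zB.
    split => //; split => //; have := Bdis _ _ vB zB; rewrite eq_sym zv => /(_ isT).
    by have := vmax _ zB; rewrite /= => h; rewrite ger0_norm; lra.
  - by move=> z z'; rewrite !inE => /andP[_ zB] /andP[_ z'B]; apply: Bdis.
lra.
Qed.

Lemma shallow_part (d : V -> V -> R) (p : V -> R) (L : R) (near : V -> V) :
  (forall x y, within w E x y (d x y) /\ forall r, within w E x y r -> d x y <= r) ->
  0 <= L -> (forall v, 0 <= p v <= L) -> (forall x y, within w T x y `|p x - p y|) ->
  (forall u v, d v (near v) <= d v (near u)) ->
  exists H : {set {set V}}, [/\ H \subset E, total_weight w H <= 6 * L &
    forall v, exists u, within w (T :|: H) v (near u) (3 * d v (near v))].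
Proof.
move=> dP L0 pL pT nearP; pose r v := d v (near v) / 4.
have d0 := distance_ge0 wE dP.
have r0 v : 0 <= r v by rewrite divr_ge0.
pose good (B : {set V}) := [forall v in B, forall v' in B, (v != v') ==>
  (r v + r v' <= `|p v - p v'|)].
have g0 : good finset.set0 by apply/forall_inP => v; rewrite inE.
have [B /maxsetP[gB Bmax] _] := maxset_exists g0.
have P v : {P : {set {set V}} | [/\ P \subset E, within w P v (near v) (d v (near v)) &
    total_weight w P <= d v (near v)]}.
  by apply: cid; apply: walk_subgraph wE (dP _ _).1.
exists (\bigcup_(v in B) projT1 (P v)); split.
- by apply/bigcupsP => v _; case: (projT2 (P v)).
- apply: le_trans (total_weight_bigcup wE _) _.
    by move=> v _; case: (projT2 (P v)).
  apply: (@le_trans _ _ (\sum_(v in B) 2 * (2 * r v))).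
    apply: ler_sum => v _; case: (projT2 (P v)) => _ _; rewrite /r; lra.
  rewrite -mulr_sumr.
  have dL v : d v (near v) <= L.
    apply: le_trans ((dP _ _).2 _ (within_sub TE (pT _ _))) _.
    by have := pL v; have := pL (near v); case: ler0P; lra.
  have : \sum_(v in B) 2 * r v <= 2 * L - (- L).
    apply: (@interval_packing B p r).
    - lra.
    - move=> v _; have := pL v; have := dL v; have := r0 v; rewrite /r; split => //; lra.
    - move=> v v' vB v'B vv'; have /forall_inP/(_ v' v'B) := forall_inP gB _ vB.
      by rewrite vv'.
  lra.
move=> v.
have [u [uB uv]] : exists u, u \in B /\ (u = v \/ `|p v - p u| < r v + r u).
  have [vB|vB] := boolP (v \in B); first by exists v; split; [|left].
  apply: contrapT => no; case/negP: vB.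
  suff gv : good (v |: B) by rewrite -(Bmax _ gv (finset.subsetUr _ _)) !inE eqxx.
  have far z : z \in B -> r v + r z <= `|p v - p z|.
    by move=> zB; rewrite leNgt; apply/negP => h; case: no; exists z; split; [|right].
  apply/forall_inP => z; rewrite !inE => zB; apply/forall_inP => z'; rewrite !inE => z'B.
  apply/implyP => zz'; case/orP: zB zz' => [/eqP->|zB]; case/orP: z'B => [/eqP->|z'B].
  - by rewrite eqxx.
  - by move=> _; apply: far.
  - by move=> _; rewrite addrC distrC; apply: far.
  - by move=> zz'; have /forall_inP/(_ z' z'B) := forall_inP gB _ zB; rewrite zz'.
exists u.
set H := \bigcup_(v in B) _.
have PH : projT1 (P u) \subset T :|: H.
  apply: fintype.subset_trans (finset.subsetUr _ _).
  exact: (finset.bigcup_sup u).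
have [_ Pu _] := projT2 (P u); have {}Pu := within_sub PH Pu.
case: uv => [uv|uv].
  by rewrite uv in Pu *; apply: (dist_le (within_dist w _) Pu); have := d0 v (near v); lra.
have h := dist_trans (within_dist w _) (within_sub (finset.subsetUl _ H) (pT v u)) Pu.
apply: (dist_le (within_dist w _) h).
have h1 := (dP _ _).2 _ (within_sub TE (pT u v)).
have h2 := distance_triangle dP u v (near v).
have h3 := nearP v u.
rewrite distrC in h1; rewrite /r in uv.
have := d0 v (near v); lra.
Qed.

Lemma terminal_spanner (K : {set V}) b : (0 < b)%N -> K != finset.set0 -> (#|K| <= 2 ^ b)%N ->
  exists H : {set {set V}}, [/\ T \subset H, H \subset E,
    total_weight w H <= total_weight w T * (1 + 3300 * (up_log 2 b + 6)%:R) &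
    forall x v r, x \in K -> within w E x v r -> within w H x v (163 * b%:R * r)].
Proof.
move=> b0 /set0Pn[k0 k0K] cK.
have b1 : 1 <= b%:R :> R by rewrite ler1n.
have wT : nonneg_weights T w by move=> e /(fintype.subsetP TE); apply: wE.
have W0 := total_weight_ge0 wT.
have [p [pL pT]] := line_embedding wT cT.
have kap1 : 6 <= (up_log 2 b + 6)%:R :> R by rewrite ler_nat leq_addl.
have [WT|Wpos] := eqVneq (total_weight w T) 0.
  exists T; split; rewrite ?subxx ?WT ?mul0r // => x v r xK xv.
  apply: (dist_le (within_dist w T) (pT x v)).
  have r0 := within_ge0 wE xv; have : 0 <= 163 * b%:R * r by rewrite !mulr_ge0.
  by have := pL x; have := pL v; rewrite WT; case: ler0P; lra.
have {}Wpos : 0 < total_weight w T by rewrite lt_neqAle eq_sym Wpos.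
have cE : connected_graph E.
  move=> x y; apply: connect_sub (cT x y) => a c ac; apply: connect1.
  exact: (fintype.subsetP TE).
have [d dP] := shortest wE cE.
have d0 := distance_ge0 wE dP.
have t1 : 1 <= 40 * b%:R :> R by lra.
pose ps := sort (longer d) [seq (x, y) | x <- enum K, y <- enum K].
have ps_sorted : sorted (longer d) ps by apply: sort_sorted => e e'; apply: le_total.
have longer_trans : transitive (longer d) by move=> e e' e''; apply: le_trans.
pose e0 := (k0, k0).
have [es [H [sub [H0 HH] Hn Hw Hps]]] := greedy_spanner wE TE dP t1 e0 ps_sorted.
have Hmono i j : (i <= j)%N -> H i \subset H j.
  move=> ij; rewrite -(subnK ij); elim: (j - i)%N => [|k IHk] //.
  by apply: fintype.subset_trans IHk _; rewrite addSn; have [] := HH (k + i)%N.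
set M := size es in Hw Hps.
pose x (j : 'I_M) := (nth e0 es j).1; pose y (j : 'I_M) := (nth e0 es j).2.
have xyK (j : 'I_M) : x j \in K /\ y j \in K.
  have : nth e0 es j \in ps by apply: (mem_subseq sub); apply: mem_nth.
  rewrite mem_sort => /allpairsP[[a c] /= [aK cK' e]]; rewrite /x /y e /=.
  by rewrite !mem_enum in aK cK'.
have wmono (i j : 'I_M) : (i <= j)%N -> d (x i) (y i) <= d (x j) (y j).
  move=> ij; have es_sorted := subseq_sorted longer_trans sub ps_sorted.
  have lrefl : reflexive (longer d) by move=> e; apply: lexx.
  by apply: (sorted_leq_nth longer_trans lrefl e0 es_sorted); rewrite ?inE ?ltn_ord.
have chw : \sum_(e <- es) d e.1 e.2 <=
    (2 + 1600 * (up_log 2 b + 6)%:R) * (2 * total_weight w T).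
  rewrite (big_nth e0) big_mkord.
  apply: (@chords_weight R V M x y (fun j => d (x j) (y j)) (fun j => within w (H j)) p _ b K) => //.
  - by move=> j; apply: within_dist.
  - by move=> j v v'; apply: within_sub (pT v v'); rewrite -H0 Hmono.
  - move=> i j ij; apply: within_sub (Hmono _ _ ij) _.
    by have [] := Hn i (ltn_ord i).
  - by move=> j; have [] := Hn j (ltn_ord j).
  - by rewrite mulr_gt0.
pose near v := [arg min_(k < k0 in K) d v k]%O.
have nearK v : near v \in K /\ forall k, k \in K -> d v (near v) <= d v k.
  by rewrite /near; case: arg_minP.
have [H2 [H2E H2w H2n]] := shallow_part dP (ltW (mulr_gt0 (ltr0n _ 2) Wpos)) pL pT
  (fun u v => (nearK v).2 _ (nearK u).1).
have TH : T \subset H M by rewrite -H0 Hmono.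
exists (H M :|: H2); split.
- exact: fintype.subset_trans TH (finset.subsetUl _ _).
- by rewrite finset.subUset H2E (HH M).2.
- apply: le_trans (total_weightU _) _.
    by move=> f; rewrite inE => /orP[/(fintype.subsetP (HH M).2)|/(fintype.subsetP H2E)]; apply: wE.
  have : 0 <= total_weight w T * ((up_log 2 b + 6)%:R - 6) by rewrite mulr_ge0 // subr_ge0.
  by move: chw Hw H2w; lra.
move=> k v r kK kv; have [u vu] := H2n v.
have [uK _] := nearK u.
have ku : within w (H M :|: H2) k (near u) (40 * b%:R * d k (near u)).
  apply: within_sub (finset.subsetUl _ _) (Hps (k, near u) _).
  by rewrite mem_sort; apply/allpairsP; exists (k, near u); rewrite /= !mem_enum.
have {}vu : within w (H M :|: H2) v (near u) (3 * d v (near v)).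
  by apply: within_sub vu; apply: finset.setSU.
apply: (dist_le (within_dist w _) (dist_trans (within_dist w _) ku (dist_sym (within_dist w _) vu))).
have h1 : d v (near v) <= d v k by apply: (nearK v).2.
have h2 : d k v <= r by apply: (dP _ _).2.
have h3 : d v (near u) <= 3 * d v (near v).
  apply: (dP _ _).2; apply: within_sub vu.
  by rewrite finset.subUset H2E (HH M).2.
have h4 := distance_triangle dP k v (near u); rewrite (distance_sym dP v k) in h1.
have h5 : d k (near u) <= 4 * r by have := d0 v (near v); lra.
have h6 : 40 * b%:R * d k (near u) <= 40 * b%:R * (4 * r) by apply: ler_wpM2l => //; lra.
have h7 : 3 * d v (near v) <= 3 * r by lra.
have h8 : r <= b%:R * r by rewrite ler_peMl //; have := d0 k v; lra.
lra.
Qed.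

End TerminalSpanner.

(** * Reweighting and the union over the scales *)

Section LightSpanner.
Variables (R : realType) (V : finType) (w : {set V} -> R) (E T : {set {set V}}).
Hypothesis wE : nonneg_weights E w.
Hypothesis TE : T \subset E.
Hypothesis cT : connected_graph T.

Lemma within_scale (w1 w2 : {set V} -> R) (F : {set {set V}}) (c : R) x y r : 0 <= c ->
  (forall e, e \in F -> w2 e <= c * w1 e) -> within w1 F x y r -> within w2 F x y (c * r).
Proof.
move=> c0 h [p [pF pl pr]]; exists p; split => //.
apply: (@le_trans _ _ (c * walk_weight w1 x p)); last by rewrite ler_wpM2l.
elim: p x pF {pl pr} => [|z p IH] x /=; first by rewrite /walk_weight !big_nil mulr0.
by move=> /andP[/h h1 /IH h2]; rewrite !walk_weight_cons mulrDr lerD.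
Qed.

(* Edges outside [T] are made more expensive by a factor [1 / delta]. *)
Lemma light_terminal_spanner (K : {set V}) b (delta : R) : 0 < delta <= 1 ->
  (0 < b)%N -> K != finset.set0 -> (#|K| <= 2 ^ b)%N ->
  exists H : {set {set V}}, [/\ T \subset H, H \subset E,
    total_weight w (H :\: T) <= delta * (3300 * (up_log 2 b + 6)%:R * total_weight w T) &
    forall x v r, x \in K -> within w E x v r -> within w H x v (163 * b%:R / delta * r)].
Proof.
move=> /andP[d0 d1] b0 K0 cK.
pose w' e := if e \in T then w e else w e / delta.
have d1' : 1 <= delta^-1 by rewrite invf_ge1.
have wT e : e \in E -> 0 <= w e by apply: wE.
have w'E : nonneg_weights E w'.
  by move=> e /wT we; rewrite /w'; case: ifP => // _; rewrite divr_ge0 // ltW.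
have w'T : total_weight w' T = total_weight w T.
  by apply: eq_bigr => e eT; rewrite /w' eT.
have [H [TH HE Hw Hs]] := terminal_spanner w'E TE cT b0 K0 cK.
exists H; split => //.
  have : total_weight w' H = total_weight w T + total_weight w (H :\: T) / delta.
    rewrite /total_weight (big_setID T) /= (finset.setIidPr TH) mulr_suml; congr (_ + _).
      exact: w'T.
    by apply: eq_bigr => e; rewrite inE => /andP[/negbTE eT _]; rewrite /w' eT.
  move=> e; rewrite e w'T mulrDr mulr1 lerD2l in Hw.
  by move: Hw; rewrite ler_pdivrMr // => /le_trans; apply; rewrite le_eqVlt; apply/orP; left; apply/eqP; ring.
move=> x v r xK xv.
have xv' : within w' E x v (delta^-1 * r).
  apply: within_scale xv; first by rewrite invr_ge0 ltW.
  move=> e /wT we; rewrite /w'; case: ifP => _; last by rewrite mulrC.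
  by rewrite ler_peMl.
have := Hs _ _ _ xK xv'; move/(within_scale (w2 := w) ler01).
rewrite mul1r mulrA; apply => e /(fintype.subsetP HE) /wT we; rewrite mul1r /w'.
by case: ifP => // _; rewrite ler_peMr.
Qed.

End LightSpanner.

Definition prioritized_stretch {R : realType} (j : nat) : R :=
  let i := up_log 2 (up_log 2 j) in
  163 * (2 ^ i)%:R * (3300 * (i + 6)%:R * (i + 1)%:R * (i + 2)%:R).

Lemma sum_telescoping (R : realType) n :
  \sum_(i < n) ((i + 1)%:R * (i + 2)%:R)^-1 <= 1 - (n + 1)%:R^-1 :> R.
Proof.
elim: n => [|n IH]; first by rewrite big_ord0 add0n invr1 subrr.
rewrite big_ord_recr /=; apply: le_trans (lerD IH (lexx _)) _.
rewrite !natrD -natr1; have := ler0n R n; set N := n%:R => N0.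
rewrite le_eqVlt; apply/orP; left; apply/eqP.
by field; rewrite !gt_eqF //; lra.
Qed.

Lemma card_ord_below n N : (#|[set j : 'I_n | (j < N)%N]| <= N)%N.
Proof.
rewrite -[X in (_ <= X)%N](size_iota 0) cardE -(size_map val).
apply: uniq_leq_size; first by rewrite map_inj_uniq ?enum_uniq //; apply: val_inj.
by move=> k /mapP[j]; rewrite mem_enum inE => jN ->; rewrite mem_iota.
Qed.

Lemma up_log2_le n : (up_log 2 n <= n)%N.
Proof. by apply: up_log_min => //; apply/ltnW/ltn_expl. Qed.

Lemma prioritized_spanner (R : realType) (V : finType) (E : {set {set V}})
    (w : {set V} -> R) (T : {set {set V}}) (rho : R) n (v : 'I_n -> V) :
  nonneg_weights E w -> T \subset E -> connected_graph T -> 0 < rho <= 1 ->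
  exists H : {set {set V}}, [/\ H \subset E,
    total_weight w H <= (1 + rho) * total_weight w T &
    forall (j i : 'I_n) r, (j < i)%N -> within w E (v j) (v i) r ->
      within w H (v j) (v i) (prioritized_stretch j.+1 / rho * r)].
Proof.
move=> wE TE cT /andP[rho0 rho1].
have W0 : 0 <= total_weight w T.
  by apply: total_weight_ge0 => e /(fintype.subsetP TE); apply: wE.
pose K (i : nat) : {set V} := [set v j | j in [set j : 'I_n | (j < 2 ^ (2 ^ i))%N]].
pose c (i : nat) : R := 3300 * (i + 6)%:R * (i + 1)%:R * (i + 2)%:R.
have c1 i : 1 <= c i.
  by rewrite /c -!natrM ler1n !muln_gt0 !addn_gt0 !orbT.
have HS (i : 'I_n) : {H : {set {set V}} | [/\ T \subset H, H \subset E,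
    total_weight w (H :\: T) <= rho / c i * (3300 * (i + 6)%:R * total_weight w T) &
    forall x y r, x \in K i -> within w E x y r ->
      within w H x y (163 * (2 ^ i)%:R / (rho / c i) * r)]}.
  apply: cid; have := @light_terminal_spanner R V w E T wE TE cT (K i) (2 ^ i)%N (rho / c i).
  rewrite up_expnK //; apply.
  - have ci := c1 i; have ci0 : 0 < c i by lra.
    by rewrite divr_gt0 //= ler_pdivrMr //; lra.
  - by rewrite expn_gt0.
  - have n0 : (0 < n)%N by apply: leq_ltn_trans (ltn_ord i).
    apply/set0Pn; exists (v (Ordinal n0)); apply/imset_f; rewrite inE /=.
    by rewrite expn_gt0.
  - exact: leq_trans (leq_imset_card _ _) (card_ord_below _ _).
pose Hi i := projT1 (HS i) :\: T.
have HiE i : Hi i \subset E.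
  by apply: fintype.subset_trans (finset.subsetDl _ _) _; case: (projT2 (HS i)).
pose H := T :|: \bigcup_(i in [set: 'I_n]) Hi i.
have HE : H \subset E by rewrite finset.subUset TE; apply/bigcupsP => i _.
exists H; split => //.
  apply: le_trans (total_weightU _) _.
    by move=> e /(fintype.subsetP HE); apply: wE.
  rewrite mulrDl mul1r lerD2l.
  apply: le_trans (total_weight_bigcup wE (fun i _ => HiE i)) _.
  apply: (@le_trans _ _ (\sum_(i < n) rho * total_weight w T * ((i + 1)%:R * (i + 2)%:R)^-1)).
    rewrite (eq_bigl xpredT) => [|i]; last by rewrite inE.
    apply: ler_sum => i _; case: (projT2 (HS i)) => _ _ h _; apply: le_trans h _.
    rewrite le_eqVlt; apply/orP; left; apply/eqP; rewrite /c.
    by have i0 := ler0n R i; field; rewrite !gt_eqF //; lra.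
  rewrite -mulr_sumr -[X in _ <= X]mulr1; apply: ler_wpM2l; first exact: mulr_ge0 (ltW rho0) W0.
  by apply: le_trans (sum_telescoping R n) _; rewrite gerBl invr_ge0.
move=> j i r ji ji_r.
pose k := up_log 2 (up_log 2 j.+1).
have kn : (k < n)%N.
  apply: leq_ltn_trans (leq_trans (up_log2_le _) (up_log2_le _)) _.
  exact: leq_ltn_trans ji (ltn_ord i).
have [TH _ _ h] := projT2 (HS (Ordinal kn)).
have HH : projT1 (HS (Ordinal kn)) \subset H.
  apply/fintype.subsetP => e eH; rewrite inE; have [//|eT] := boolP (e \in T).
  by apply/bigcupP; exists (Ordinal kn); rewrite ?inE ?eT.
apply: (dist_le (within_dist w H) (within_sub HH (h _ _ _ _ ji_r))).
  apply/imset_f; rewrite inE /=; apply: leq_trans (up_logP _ (isT : (1 < 2)%N)) _.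
  by rewrite leq_exp2l // up_logP.
rewrite /= /prioritized_stretch -/k -/(c k) le_eqVlt; apply/orP; left; apply/eqP.
by rewrite invf_div; ring.
Qed.

Lemma prioritized_stretch_ge0 (R : realType) j : 0 <= prioritized_stretch j :> R.
Proof. by rewrite /prioritized_stretch -!natrM ler0n. Qed.

Lemma prioritized_stretch_bound (R : realType) : exists C : R, exists x0 : R, 0 < C /\
  forall j : nat, x0 <= j%:R ->
    prioritized_stretch j <= C * (ln j%:R * ln (ln j%:R) ^+ 3) /\
    0 <= ln j%:R * ln (ln j%:R) ^+ 3 :> R.
Proof.
pose c : R := ln 2.
have c0 : 0 < c by rewrite ln_gt0 // ltr1n.
pose D := 2 / c + 6; have D0 : 0 < D by rewrite addr_gt0 // divr_gt0.
pose X := 1 + `|ln (4 / c)|.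
exists (163 * 3300 * (4 / c) * D ^+ 3), (Num.max 3 (expR (Num.max c (expR X)))).
split.
  by do 3?[apply: mulr_gt0]; rewrite ?ltr0n ?exprn_gt0 ?invr_gt0.
move=> j; rewrite ge_max => /andP[j3 jx].
have jpos : 0 < j%:R :> R by lra.
set Lm := ln j%:R.
have Lm1 : Num.max c (expR X) <= Lm.
  by rewrite -(expRK (Num.max c (expR X))) /Lm ler_ln // posrE expR_gt0.
have [Lmc LmX] : c <= Lm /\ expR X <= Lm by move: Lm1; rewrite ge_max => /andP.
have Lm0 : 0 < Lm by lra.
set l := ln Lm.
have lX : X <= l by rewrite -(expRK X) /l ler_ln // posrE expR_gt0.
have l1 : 1 <= l by apply: le_trans lX; rewrite /X lerDl.
have lc : ln (4 / c) <= l.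
  by apply: le_trans (ler_norm _) (le_trans _ lX); rewrite /X lerDr.
split; last by rewrite mulr_ge0 ?exprn_ge0 //; lra.
rewrite /prioritized_stretch; set B := up_log 2 j; set i := up_log 2 B.
have j3' : (2 < j)%N by rewrite -(ltr_nat R); lra.
have ln2 n : ln ((2 ^ n)%:R : R) = n%:R * c by rewrite natrX lnXn // mulr_natl.
have B0 : (0 < B)%N by rewrite up_log_gt0 /= ltnW.
have hB : B%:R * c <= Lm + c.
  have : (2 ^ B.-1 < j)%N by apply: up_log_gtn => //; apply: ltnW.
  rewrite -(ltr_nat R) => h; have : ln (2 ^ B.-1)%:R < Lm by rewrite ltr_ln // posrE ltr0n expn_gt0.
  by rewrite ln2 -(prednK B0) -natr1; lra.
have B1 : (1 < B)%N.
  rewrite ltnNge; apply/negP => B1; have := up_logP j (isT : (1 < 2)%N).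
  rewrite -/B => h; have := leq_trans h (leq_pexp2l (isT : (0 < 2)%N) B1).
  by rewrite leqNgt j3'.
have i0 : (0 < i)%N by rewrite up_log_gt0 /= B1.
have h2i : (2 ^ i)%:R <= 4 / c * Lm :> R.
  have : (2 ^ i.-1 < B)%N by apply: up_log_gtn.
  rewrite -(ltr_nat R) -{2}(prednK i0) expnS natrM => h.
  rewrite mulrAC ler_pdivlMr //.
  have : (2 ^ i.-1)%:R * c <= B%:R * c by rewrite ler_pM2r // ltW.
  lra.
have hi : i%:R <= 2 / c * l.
  rewrite mulrAC ler_pdivlMr // -ln2.
  have : ln (2 ^ i)%:R <= ln (4 / c * Lm) :> R.
    by rewrite ler_ln // posrE ?ltr0n ?expn_gt0 // mulr_gt0 // divr_gt0.
  rewrite lnM ?posrE // ?divr_gt0 // -/l; lra.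
have i6 k : (k <= 6)%N -> (i + k)%:R <= D * l.
  move=> k6; have : k%:R <= 6 :> R by rewrite ler_nat.
  rewrite natrD /D mulrDl; lra.
have Dl : 0 <= D * l by rewrite mulr_ge0 //; lra.
have h3 : (i + 6)%:R * (i + 1)%:R * (i + 2)%:R <= (D * l) ^+ 3.
  rewrite !exprS expr0 mulr1 mulrA; apply: ler_pM; rewrite ?mulr_ge0 ?i6 //.
  by apply: ler_pM; rewrite ?i6.
have h4 : (2 ^ i)%:R * ((i + 6)%:R * (i + 1)%:R * (i + 2)%:R) <= 4 / c * Lm * (D * l) ^+ 3.
  by apply: ler_pM; rewrite ?mulr_ge0.
move: h4; rewrite exprMn; lra.
Qed.

Lemma softO_prioritized_stretch (R : realType) :
  softO (prioritized_stretch : nat -> R) (fun j => ln j%:R).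
Proof.
exists 3%N; apply/eqO_exP; have [C [x0 [C0 h]]] := prioritized_stretch_bound R.
exists C => //; near=> j.
have [h1 h2] : prioritized_stretch j <= C * (ln j%:R * ln (ln j%:R) ^+ 3) /\
    0 <= ln j%:R * ln (ln j%:R) ^+ 3 :> R.
  by apply: h; near: j; exact: nbhs_infty_ger.
by rewrite ger0_norm ?prioritized_stretch_ge0 // ger0_norm.
Unshelve. all: by end_near. Qed.

Theorem mainTheorem1 (R : realType) :
  exists alpha : nat -> R,
    softO alpha (fun j => ln j%:R) /\
    forall (V : finType) (E : {set {set V}}) (w : {set V} -> R)
      (T : {set {set V}}) (rho : R) (n : nat) (v : 'I_n -> V),
      is_graph E -> connected_graph E -> nonneg_weights E w ->
      is_MST E w T ->
      0 < rho < 1 ->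
      bijective v ->
      exists H : {set {set V}},
        [/\ spanner E H,
            (lightness w T H <= (1 + rho)%:E)%E &
            prioritized_distortion w E H v (fun j => alpha j / rho)].
Proof.
exists prioritized_stretch; split; first exact: softO_prioritized_stretch.
move=> V E w T rho n v _ cE wE [[TE cT _] _] /andP[rho0 rho1] _.
have rho01 : 0 < rho <= 1 by rewrite rho0 ltW.
have [H [HE Hw Hs]] := prioritized_spanner v wE TE cT rho01.
have W0 : 0 <= total_weight w T.
  by apply: total_weight_ge0 => e /(fintype.subsetP TE); apply: wE.
have H0 : 0 <= total_weight w H.
  by apply: total_weight_ge0 => e /(fintype.subsetP HE); apply: wE.
exists H; split => //.
  rewrite /lightness inver; have [W|W] := eqVneq (total_weight w T) 0.
    have -> : total_weight w H = 0 by apply/eqP; rewrite eq_le H0 andbT -(mulr0 (1 + rho)) -W.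
    by rewrite mul0e lee_fin; lra.
  by rewrite -EFinM lee_fin ler_pdivrMr // lt_neqAle eq_sym W.
move=> j i ji; have [d dP] := shortest wE cE; have [h1 h2] := dP (v j) (v i).
rewrite /distortion_at_most (dist_shortest h1 h2) -EFinM.
exact: dist_within (Hs _ _ _ ji h1).
Qed.
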